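(* Let $p,q$ be positive integers. There is a presentation of the ring of invariants, i.e. an isomorphism of superalgebras $$\tilde{\mathcal O}^{\mathrm{SL}(1|1)}\;\cong\;\mathbb C[Y_{i|\hat\mu},\,Y_{\hat\mu|\hat\nu},\,Y^*_{j|\hat\nu},\,Y^*_{i|j}]\,/\,\mathrm I_{sp},$$ in which the variables $Y$ correspond to the super minors and fake super minors $X$ with the same indices. Here $1\le i,j\le p$, $\hat1\le\hat\mu,\hat\nu\le\hat q$, $Y_{i|\hat\mu}$ and $Y^*_{j|\hat\nu}$ are even variables, $Y_{\hat\mu|\hat\nu}$ and $Y^*_{i|j}$ are odd variables, $\mathbb C[\dots]$ is the free commutative superalgebra on them, and $\mathrm I_{sp}$ is the ideal generated by the super Pl\''ucker relations, for all $i,j,k\in\{1,\dots,p\}$ and $\hat\mu,\hat\nu,\hat\lambda\in\{\hat1,\dots,\hat q\}$: $$Y_{i|\hat\mu}Y^*_{i|\hat\mu}=1,$$ $$Y_{i|\hat\mu}Y_{j|\hat\nu}=\mathrm{Ber}\begin{pmatrix} Y_{j|\hat\mu} & Y_{\hat\nu|\hat\mu} \\ Y^*_{i|j} & Y^*_{i|\hat\nu} \end{pmatrix}=Y_{i|\hat\nu}\big(Y_{j|\hat\mu}-Y_{\hat\nu|\hat\mu}Y_{i|\hat\nu}Y^*_{i|j}\big),$$ $$Y_{i|\hat\mu}Y_{\hat\lambda|\hat\nu}=\mathrm{Ber}\begin{pmatrix} Y_{\hat\lambda|\hat\mu} & Y_{\hat\nu|\hat\mu} \\ Y^*_{i|\hat\lambda}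 & Y^*_{i|\hat\nu} \end{pmatrix}=Y_{i|\hat\nu}\big(Y_{\hat\lambda|\hat\mu}-Y_{\hat\nu|\hat\mu}Y_{i|\hat\nu}Y^*_{i|\hat\lambda}\big),$$ $$Y^*_{i|\hat\mu}Y^*_{j|k}=\mathrm{Ber}^*\begin{pmatrix} Y_{j|\hat\mu} & Y_{k|\hat\mu} \\ Y^*_{i|j} & Y^*_{i|k} \end{pmatrix}=Y^*_{j|\hat\mu}\big(Y^*_{i|k}-Y^*_{i|j}Y^*_{j|\hat\mu}Y_{k|\hat\mu}\big),$$ where in $\mathrm{Ber}$ and $\mathrm{Ber}^*$ the inverses $(Y^*_{i|\hat\nu})^{-1}$ and $(Y_{j|\hat\mu})^{-1}$ are $Y_{i|\hat\nu}$ and $Y^*_{j|\hat\mu}$ respectively, in accordance with the first relation.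
   Context: The ground field is $\mathbb C$. A commutative superalgebra is a $\mathbb Z_2$-graded associative unital algebra $\mathcal A=\mathcal A_0\oplus\mathcal A_1$ with $ab=(-1)^{p(a)p(b)}ba$ for homogeneous elements. $\mathcal O$ is the free commutative superalgebra over $\mathbb C$ on even generators $x_{1j}$, $x_{\hat1\hat\mu}$ and odd generators $x_{1\hat\mu}$, $x_{\hat1j}$, $1\le j\le p$, $\hat1\le\hat\mu\le\hat q$; these are the coordinates of the even supermatrix of size $1|1\times p|q$ whose even columns are $c_j=\begin{pmatrix} x_{1j} \\ x_{\hat1j} \end{pmatrix}$ and whose odd columns are $c_{\hat\mu}=\begin{pmatrix} x_{1\hat\mu} \\ x_{\hat1\hat\mu} \end{pmatrix}$. $\tilde{\mathcal O}$ is the localization of $\mathcal O$ obtained by inverting all $x_{1j}$ and all $x_{\hat1\hat\mu}$. For a commutative superalgebra $\mathcal A$, $\tilde{\mathrm M}_{1|1\times p|q}(\mathcal A)$ is the set of $2\times(p+q)$ matrices over $\mathcal A$ whose first $p$ columns are of the form (even; odd), whose last $q$ columns are of the form (odd; even), and all of whose even entries are invertible. For $f\in\tilde{\mathcal O}$ and $M$ in this set, $f(M)\in\mathcal A$ is obtained by substituting the entries of $M$ for the generators. $\mathrm{SL}(1|1)(\mathcal A)$ is the group of invertible matrices $\begin{pmatrix} a & b \\ c & d \end{pmatrix}$ with $a,d\in\mathcal A_0$, $b,c\in\mathcal A_1$ and $d^{-1}(a-bd^{-1}c)=1$. $\tilde{\mathcal O}^{\mathrm{SL}(1|1)}$ is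 the set of $f\in\tilde{\mathcal O}$ with $f(gM)=f(M)$ for all commutative superalgebras $\mathcal A$, all $g\in\mathrm{SL}(1|1)(\mathcal A)$ and all $M\in\tilde{\mathrm M}_{1|1\times p|q}(\mathcal A)$. For a $2\times2$ matrix $B=\begin{pmatrix} a & b \\ c & d \end{pmatrix}$: $\mathrm{Ber}\,B:=d^{-1}(a-b\,d^{-1}c)$ when $d$ is even and invertible, and $\mathrm{Ber}^*B:=a^{-1}(d-c\,a^{-1}b)$ when $a$ is even and invertible. With $(c\,|\,c')$ the $2\times2$ matrix with columns $c,c'$, the super minors are $X_{i|\hat\mu}:=\mathrm{Ber}(c_i|c_{\hat\mu})$, $X^*_{i|\hat\mu}:=\mathrm{Ber}^*(c_i|c_{\hat\mu})$ (even), and the fake super minors are $X_{\hat\mu|\hat\nu}:=\mathrm{Ber}(c_{\hat\mu}|c_{\hat\nu})$, $X^*_{i|j}:=\mathrm{Ber}^*(c_i|c_j)$ (odd). *)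

(* Defs.v *)
From HB Require Import structures.
From mathcomp Require Import all_boot all_order all_algebra.
From mathcomp Require Import finmap.
From mathcomp Require Import boolp classical_sets reals.
From mathcomp Require Import complex.
From mathcomp Require Import monalg.

Set Implicit Arguments.
Unset Strict Implicit.
Unset Printing Implicit Defensive.

Import GRing.Theory.

Local Open Scope ring_scope.
Local Open Scope quotient_scope.

(* The parity false is even, the parity true is odd. As an algType is nontrivial,
   the zero algebra is left out. *)
HB.mixin Record Algebra_isSuperalgebra (K : fieldType) A
    of GRing.Algebra K A := {
  homog : bool -> set A;
  homog0 : forall e, homog e 0;
  homog1 : homog false 1;
  homog_lin : forall e (k : K) x y,
    homog e x -> homog e y -> homog e (k *: x + y);
  homogM : forall d e x y, homog d x -> homog e y -> homog (d (+) e) (x * y);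
  homog_dec : forall x,
    exists2 x0, homog false x0 & exists2 x1, homog true x1 & x = x0 + x1;
  homog_disj : forall x, homog false x -> homog true x -> x = 0
}.

#[short(type="superalgType")]
HB.structure Definition Superalgebra (K : fieldType) :=
  {A of GRing.Algebra K A & Algebra_isSuperalgebra K A}.

HB.mixin Record Superalgebra_isCommutative (K : fieldType) A
    of Superalgebra K A := {
  supermulrC : forall d e (x y : A), homog d x -> homog e y ->
    x * y = (-1) ^+ (d && e) * (y * x)
}.

#[short(type="comSuperalgType")]
HB.structure Definition ComSuperalgebra (K : fieldType) :=
  {A of Superalgebra K A & Superalgebra_isCommutative K A}.

Arguments homogM {K s d e x y} : rename.
Arguments supermulrC {K s d e x y} : rename.

Definition superalg_morph (K : fieldType) (A B : superalgType K)
    (f : A -> B) : Prop :=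
  [/\ linear f, monoid_morphism f & forall e x, homog e x -> homog e (f x)].

Definition superalg_iso (K : fieldType) (A B : superalgType K)
    (f : A -> B) : Prop :=
  superalg_morph f /\ bijective f.

Section SuperalgebraTheory.
Variables (K : fieldType) (A : superalgType K).
Implicit Types (x y : A).

Lemma homogD e x y : homog e x -> homog e y -> homog e (x + y).
Proof. by move=> hx hy; rewrite -[x]scale1r; apply: homog_lin. Qed.

Lemma homogZ e (k : K) x : homog e x -> homog e (k *: x).
Proof. by move=> hx; rewrite -[_ *: _]addr0; apply: homog_lin (homog0 _). Qed.

Lemma homogN e x : homog e x -> homog e (- x).
Proof. by move=> hx; rewrite -scaleN1r; apply: homogZ. Qed.

Lemma homogB e x y : homog e x -> homog e y -> homog e (x - y).
Proof. by move=> hx hy; apply/homogD/homogN. Qed.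

Lemma homog_sum e (I : Type) (r : seq I) (P : pred I) (F : I -> A) :
  (forall i, P i -> homog e (F i)) -> homog e (\sum_(i <- r | P i) F i).
Proof.
by move=> h; elim/big_ind: _ => //; [apply: homog0 | apply: homogD].
Qed.

Lemma homog_uniq x0 x1 y0 y1 :
  homog false x0 -> homog true x1 -> homog false y0 -> homog true y1 ->
  x0 + x1 = y0 + y1 -> x0 = y0 /\ x1 = y1.
Proof.
move=> hx0 hx1 hy0 hy1 E.
have E' : x0 - y0 = y1 - x1.
  by apply/eqP; rewrite subr_eq addrAC eq_sym subr_eq E addrC.
have /eqP : x0 - y0 = 0.
  by apply: homog_disj; [apply: homogB | rewrite E'; apply: homogB].
rewrite subr_eq0 => /eqP E0; split=> //.
by move: E; rewrite E0 => /addrI.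
Qed.

Lemma homog_sign (b : bool) : homog false ((-1) ^+ b : A).
Proof. by case: b; rewrite ?expr1 ?expr0; [apply: homogN|]; apply: homog1. Qed.

End SuperalgebraTheory.

Section MorphTheory.
Variables (K : fieldType) (A B : superalgType K) (f : A -> B).
Hypothesis fP : superalg_morph f.

Lemma morphS_D x y : f (x + y) = f x + f y.
Proof. by have [l _ _] := fP; have := l 1 x y; rewrite !scale1r. Qed.
Lemma morphS_0 : f 0 = 0.
Proof. by apply: (addrI (f 0)); rewrite -morphS_D !addr0. Qed.
Lemma morphS_Z k x : f (k *: x) = k *: f x.
Proof. by have [l _ _] := fP; have := l k x 0; rewrite !addr0 morphS_0 addr0. Qed.
Lemma morphS_N x : f (- x) = - f x.
Proof. by rewrite -!scaleN1r morphS_Z. Qed.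
Lemma morphS_B x y : f (x - y) = f x - f y.
Proof. by rewrite morphS_D morphS_N. Qed.
Lemma morphS_1 : f 1 = 1.
Proof. by have [_ [? _] _] := fP. Qed.
Lemma morphS_M x y : f (x * y) = f x * f y.
Proof. by have [_ [_ ?] _] := fP. Qed.
Lemma morphS_homog e x : homog e x -> homog e (f x).
Proof. by have [_ _] := fP; apply. Qed.
Lemma morphS_sum (I : Type) (r : seq I) (P : pred I) (F : I -> A) :
  f (\sum_(i <- r | P i) F i) = \sum_(i <- r | P i) f (F i).
Proof. exact: (big_morph f morphS_D morphS_0). Qed.
Lemma morphS_prod (I : Type) (r : seq I) (P : pred I) (F : I -> A) :
  f (\prod_(i <- r | P i) F i) = \prod_(i <- r | P i) f (F i).
Proof. exact: (big_morph f morphS_M morphS_1). Qed.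
Lemma morphS_sign (b : bool) : f ((-1) ^+ b) = (-1) ^+ b.
Proof. by case: b; rewrite ?expr1 ?expr0 ?morphS_N morphS_1. Qed.
Lemma morphS_supercomm (b : bool) x y z t :
  f (x * y - (-1) ^+ b * (z * t)) = f x * f y - (-1) ^+ b * (f z * f t).
Proof. by rewrite morphS_B morphS_M morphS_M morphS_sign morphS_M. Qed.

End MorphTheory.

Lemma superalg_morph_comp (K : fieldType) (A B C : superalgType K)
    (g : B -> C) (f : A -> B) :
  superalg_morph g -> superalg_morph f -> superalg_morph (g \o f).
Proof.
move=> gP fP; split=> [k x y||e x hx] /=.
- by rewrite (morphS_D fP) (morphS_Z fP) (morphS_D gP) (morphS_Z gP).
- split=> [|x y] /=; first by rewrite (morphS_1 fP) (morphS_1 gP).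
  by rewrite (morphS_M fP) (morphS_M gP).
- by apply: (morphS_homog gP); apply: (morphS_homog fP).
Qed.

Definition sunit (A : nzRingType) (x : A) : Prop :=
  exists y : A, x * y = 1 /\ y * x = 1.

(* It is 0 when x is not invertible. *)
Definition sinv (A : nzRingType) (x : A) : A :=
  xget 0 [set y | x * y = 1 /\ y * x = 1]%classic.

Lemma sinvP (A : nzRingType) (x : A) :
  sunit x -> x * sinv x = 1 /\ sinv x * x = 1.
Proof. by rewrite /sinv; case: xgetP => [y _ //|h [y /h]]. Qed.

Lemma sinv_eq (A : nzRingType) (x y : A) :
  x * y = 1 -> y * x = 1 -> sinv x = y.
Proof.
move=> xy yx; have [h _] : x * sinv x = 1 /\ sinv x * x = 1.
  by apply: sinvP; exists y.
by rewrite -[LHS]mul1r -yx -mulrA h mulr1.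
Qed.

Lemma sinv_homog (K : fieldType) (A : superalgType K) (x : A) :
  sunit x -> homog false x -> homog false (sinv x).
Proof.
move=> ux hx; have [xy yx] := sinvP ux.
have [y0 h0 [y1 h1 E]] := homog_dec (sinv x).
have [xy0 _] : x * y0 = 1 /\ x * y1 = 0.
  have g0 : homog false (x * y0) := homogM hx h0.
  have g1 : homog true (x * y1) := homogM hx h1.
  apply: (homog_uniq g0 g1 homog1 (homog0 true)).
  by rewrite addr0 -mulrDr -E.
by rewrite -[sinv x]mulr1 -xy0 mulrA yx mul1r.
Qed.

Lemma morphS_sinv (K : fieldType) (A B : superalgType K) (f : A -> B) x :
  superalg_morph f -> sunit x -> sunit (f x) /\ f (sinv x) = sinv (f x).
Proof.
move=> fP /sinvP[h1 h2].
have k1 : f x * f (sinv x) = 1 by rewrite -(morphS_M fP) h1 (morphS_1 fP).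
have k2 : f (sinv x) * f x = 1 by rewrite -(morphS_M fP) h2 (morphS_1 fP).
by split; [exists (f (sinv x)) | rewrite (sinv_eq k1 k2)].
Qed.

Inductive ideal_gen (A : nzRingType) (S : A -> Prop) : A -> Prop :=
| ideal_gen0 : ideal_gen S 0
| ideal_genD x y : ideal_gen S x -> ideal_gen S y -> ideal_gen S (x + y)
| ideal_genM a s b : S s -> ideal_gen S (a * s * b).

Lemma ideal_gen_morph (K : fieldType) (A B : superalgType K) (S : A -> Prop)
    (f : A -> B) x :
  superalg_morph f -> (forall s, S s -> f s = 0) -> ideal_gen S x -> f x = 0.
Proof.
move=> fP fS; elim=> [|{}x y _ hx _ hy|a s b Ss]; first exact: morphS_0.
- by rewrite (morphS_D fP) hx hy addr0.
- by rewrite !(morphS_M fP) (fS _ Ss) mulr0 mul0r.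
Qed.

Lemma ideal_gen_proper (K : fieldType) (A B : superalgType K) (S : A -> Prop)
    (f : A -> B) :
  superalg_morph f -> (forall s, S s -> f s = 0) -> ~ ideal_gen S 1.
Proof.
move=> fP fS /(ideal_gen_morph fP fS) /eqP.
by rewrite (morphS_1 fP) (negPf (oner_neq0 _)).
Qed.

(* A set of homogeneous elements that generates a proper two-sided ideal. *)
Record homset (K : fieldType) (A : superalgType K) := Homset {
  homset_set :> A -> Prop;
  homsetP : forall s, homset_set s -> exists e, homog e s;
  homset_proper : ~ ideal_gen homset_set 1
}.

Section Quotient.
Variables (K : fieldType) (A : superalgType K) (S : homset A).
Local Notation I := (ideal_gen S).

Lemma ideal_genS s : S s -> I s.
Proof. by move=> Ss; rewrite -[s]mul1r -[1 * s]mulr1; apply: ideal_genM. Qed.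

Lemma ideal_genMl a x : I x -> I (a * x).
Proof.
elim=> [|{}x y _ hx _ hy|b s c Ss]; first by rewrite mulr0; apply: ideal_gen0.
- by rewrite mulrDr; apply: ideal_genD.
- by rewrite !mulrA; apply: ideal_genM.
Qed.

Lemma ideal_genMr a x : I x -> I (x * a).
Proof.
elim=> [|{}x y _ hx _ hy|b s c Ss]; first by rewrite mul0r; apply: ideal_gen0.
- by rewrite mulrDl; apply: ideal_genD.
- by rewrite -!mulrA mulrA; apply: ideal_genM.
Qed.

Lemma ideal_genN x : I x -> I (- x).
Proof. by move=> Ix; rewrite -mulN1r; apply: ideal_genMl. Qed.

Lemma ideal_genB x y : I x -> I y -> I (x - y).
Proof. by move=> Ix Iy; apply/ideal_genD/ideal_genN. Qed.

Lemma ideal_genZ (k : K) x : I x -> I (k *: x).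
Proof. by move=> Ix; rewrite -[x]mul1r scalerAl; apply: ideal_genMl. Qed.

Lemma ideal_gen_dec x : I x ->
  exists x0 x1, [/\ I x0, homog false x0, I x1, homog true x1 & x = x0 + x1].
Proof.
elim=> [|{}x y _ [x0 [x1 [? ? ? ? ->]]] _ [y0 [y1 [? ? ? ? ->]]]|a s b Ss].
- by exists 0, 0; split; rewrite ?addr0 //; do ?exact: ideal_gen0; exact: homog0.
- exists (x0 + y0), (x1 + y1); split; rewrite 1?addrACA //;
    by [apply: ideal_genD | apply: homogD].
have [e hs] := homsetP Ss.
have [a0 ha0 [a1 ha1 ->]] := homog_dec a.
have [b0 hb0 [b1 hb1 ->]] := homog_dec b.
have h (d d' : bool) (a' b' : A) :
    homog d a' -> homog d' b' -> homog (d (+) e (+) d') (a' * s * b').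
  by move=> ha hb; apply: homogM hb; apply: homogM.
pose u := a0 * s * b0 + a1 * s * b1; pose v := a0 * s * b1 + a1 * s * b0.
have E : (a0 + a1) * s * (b0 + b1) = u + v.
  rewrite /u /v !mulrDl !mulrDr -!addrA; congr (_ + _).
  by rewrite addrC -!addrA addrC -!addrA; congr (_ + _); rewrite addrC.
have Iu : I u by apply: ideal_genD; apply: ideal_genM.
have Iv : I v by apply: ideal_genD; apply: ideal_genM.
have hu : homog e u.
  apply: homogD; [have := h _ _ _ _ ha0 hb0|have := h _ _ _ _ ha1 hb1];
  by case: (e).
have hv : homog (~~ e) v.
  apply: homogD; [have := h _ _ _ _ ha0 hb1|have := h _ _ _ _ ha1 hb0];
  by case: (e).
by rewrite E; case: (e) hu hv => hu hv;
  [exists v, u; rewrite addrC | exists u, v].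
Qed.

Definition quot_rel (x y : A) : bool := `[< I (x - y) >].

Lemma quot_rel_equiv : equiv_class_of quot_rel.
Proof.
split=> [x|x y|y x z]; rewrite /quot_rel.
- by apply/asboolP; rewrite subrr; apply: ideal_gen0.
- by apply/asboolP/asboolP=> /ideal_genN; rewrite opprB.
- move=> /asboolP h1 /asboolP h2; apply/asboolP.
  by rewrite -(subrK y x) -addrA; apply: ideal_genD.
Qed.

Canonical quot_equiv := EquivRelPack quot_rel_equiv.
Canonical quot_equiv_direct := defaultEncModRel quot_rel.

(* The quotient of A by the two-sided ideal generated by S. *)
Definition superquot : Type := {eq_quot quot_rel}.
HB.instance Definition _ := Choice.on superquot.
HB.instance Definition _ := EqQuotient.on superquot.

Definition superproj (x : A) : superquot := \pi_superquot x.

Lemma superproj_eq x y : superproj x = superproj y <-> I (x - y).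
Proof.
by split=> [/eqmodP /asboolP //|h]; apply/eqmodP/asboolP.
Qed.

Lemma superproj_repr x : superproj (repr x) = x.
Proof. exact: reprK. Qed.

Lemma repr_superproj x : I (repr (superproj x) - x).
Proof. by apply/superproj_eq; rewrite superproj_repr. Qed.

Definition quot_add (x y : superquot) : superquot := superproj (repr x + repr y).
Definition quot_opp (x : superquot) : superquot := superproj (- repr x).
Definition quot_mul (x y : superquot) : superquot := superproj (repr x * repr y).
Definition quot_scale (k : K) (x : superquot) : superquot :=
  superproj (k *: repr x).

Lemma projD x y : superproj (x + y) = quot_add (superproj x) (superproj y).
Proof.
apply/superproj_eq; rewrite -(opprK (_ - _)); apply: ideal_genN.
by rewrite opprB opprD addrACA; apply: ideal_genD; apply: repr_superproj.
Qed.
Lemma projN x : superproj (- x) = quot_opp (superproj x).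
Proof.
apply/superproj_eq; rewrite opprK addrC; exact: repr_superproj.
Qed.
Lemma projM x y : superproj (x * y) = quot_mul (superproj x) (superproj y).
Proof.
apply/superproj_eq; rewrite -(opprK (_ - _)); apply: ideal_genN; rewrite opprB.
set x' := repr _; set y' := repr _.
rewrite -(subrK (x' * y) (x' * y')) -addrA -mulrBr -mulrBl.
by apply: ideal_genD; [apply: ideal_genMl | apply: ideal_genMr];
  apply: repr_superproj.
Qed.
Lemma projZ k x : superproj (k *: x) = quot_scale k (superproj x).
Proof.
apply/superproj_eq; rewrite -(opprK (_ - _)); apply: ideal_genN; rewrite opprB.
by rewrite -scalerBr; apply: ideal_genZ; apply: repr_superproj.
Qed.

Lemma quot_ind (P : superquot -> Prop) :
  (forall x, P (superproj x)) -> forall x, P x.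
Proof. by move=> h x; rewrite -[x]superproj_repr. Qed.

Fact quot_addA : associative quot_add.
Proof.
by elim/quot_ind=> x; elim/quot_ind=> y; elim/quot_ind=> z; rewrite -!projD addrA.
Qed.
Fact quot_addC : commutative quot_add.
Proof. by elim/quot_ind=> x; elim/quot_ind=> y; rewrite -!projD addrC. Qed.
Fact quot_add0 : left_id (superproj 0) quot_add.
Proof. by elim/quot_ind=> x; rewrite -!projD add0r. Qed.
Fact quot_addN : left_inverse (superproj 0) quot_opp quot_add.
Proof. by elim/quot_ind=> x; rewrite -projN -projD addNr. Qed.
HB.instance Definition _ :=
  GRing.isZmodule.Build superquot quot_addA quot_addC quot_add0 quot_addN.

Lemma superprojD x y : superproj (x + y) = superproj x + superproj y.
Proof. exact: projD. Qed.

Fact quot_mulA : associative quot_mul.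
Proof.
by elim/quot_ind=> x; elim/quot_ind=> y; elim/quot_ind=> z; rewrite -!projM mulrA.
Qed.
Fact quot_mul1l : left_id (superproj 1) quot_mul.
Proof. by elim/quot_ind=> x; rewrite -projM mul1r. Qed.
Fact quot_mul1r : right_id (superproj 1) quot_mul.
Proof. by elim/quot_ind=> x; rewrite -projM mulr1. Qed.
Fact quot_mulDl : left_distributive quot_mul quot_add.
Proof.
elim/quot_ind=> x; elim/quot_ind=> y; elim/quot_ind=> z.
by rewrite -projD -!projM -projD mulrDl.
Qed.
Fact quot_mulDr : right_distributive quot_mul quot_add.
Proof.
elim/quot_ind=> x; elim/quot_ind=> y; elim/quot_ind=> z.
by rewrite -projD -!projM -projD mulrDr.
Qed.
Fact quot_oner_neq0 : superproj 1 != 0.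
Proof.
by apply/eqP=> /superproj_eq; rewrite subr0; apply: homset_proper.
Qed.
HB.instance Definition _ := GRing.Zmodule_isNzRing.Build superquot
  quot_mulA quot_mul1l quot_mul1r quot_mulDl quot_mulDr quot_oner_neq0.

Fact quot_scaleA a b v : quot_scale a (quot_scale b v) = quot_scale (a * b) v.
Proof. by elim/quot_ind: v => x; rewrite -!projZ scalerA. Qed.
Fact quot_scale1 : left_id 1 quot_scale.
Proof. by elim/quot_ind=> x; rewrite -!projZ scale1r. Qed.
Fact quot_scaleDr : right_distributive quot_scale +%R.
Proof.
move=> a; elim/quot_ind=> x; elim/quot_ind=> y.
by rewrite -superprojD -!projZ scalerDr superprojD.
Qed.
Fact quot_scaleDl v : {morph quot_scale^~ v : a b / a + b}.
Proof. by elim/quot_ind: v => x a b; rewrite -!projZ scalerDl superprojD. Qed.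
HB.instance Definition _ := GRing.Zmodule_isLmodule.Build K superquot
  quot_scaleA quot_scale1 quot_scaleDr quot_scaleDl.

Lemma superproj0 : superproj 0 = 0. Proof. by []. Qed.
Lemma superproj1 : superproj 1 = 1. Proof. by []. Qed.
Lemma superprojM x y : superproj (x * y) = superproj x * superproj y.
Proof. exact: projM. Qed.
Lemma superprojZ k x : superproj (k *: x) = k *: superproj x.
Proof. exact: projZ. Qed.

Fact quot_scaleAl k (x y : superquot) : k *: (x * y) = (k *: x) * y.
Proof.
by elim/quot_ind: x => x; elim/quot_ind: y => y;
  rewrite -superprojM -!superprojZ -superprojM scalerAl.
Qed.
Fact quot_scaleAr k (x y : superquot) : k *: (x * y) = x * (k *: y).
Proof.
by elim/quot_ind: x => x; elim/quot_ind: y => y;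
  rewrite -superprojM -!superprojZ -superprojM scalerAr.
Qed.
HB.instance Definition _ :=
  GRing.Lmodule_isLalgebra.Build K superquot quot_scaleAl.
HB.instance Definition _ :=
  GRing.Lalgebra_isAlgebra.Build K superquot quot_scaleAr.

Definition quot_homog (e : bool) : set superquot :=
  [set z | exists2 x, homog e x & z = superproj x]%classic.

Fact quot_homog0 e : quot_homog e 0.
Proof. by exists 0 => //; apply: homog0. Qed.
Fact quot_homog1 : quot_homog false 1.
Proof. by exists 1 => //; apply: homog1. Qed.
Fact quot_homog_lin e (k : K) x y :
  quot_homog e x -> quot_homog e y -> quot_homog e (k *: x + y).
Proof.
move=> [x' hx ->] [y' hy ->]; exists (k *: x' + y'); first exact: homog_lin.
by rewrite superprojD superprojZ.
Qed.
Fact quot_homogM d e x y :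
  quot_homog d x -> quot_homog e y -> quot_homog (d (+) e) (x * y).
Proof.
move=> [x' hx ->] [y' hy ->]; exists (x' * y'); first exact: homogM.
by rewrite superprojM.
Qed.
Fact quot_homog_dec x : exists2 x0, quot_homog false x0 &
  exists2 x1, quot_homog true x1 & x = x0 + x1.
Proof.
elim/quot_ind: x => x; have [x0 h0 [x1 h1 ->]] := homog_dec x.
exists (superproj x0); first by exists x0.
by exists (superproj x1); [exists x1 | rewrite superprojD].
Qed.
Fact quot_homog_disj x : quot_homog false x -> quot_homog true x -> x = 0.
Proof.
move=> [x0 h0 ->] [x1 h1] /superproj_eq /ideal_gen_dec[y0 [y1 [I0 g0 I1 g1 E]]].
have [E0 _] : x0 = y0 /\ - x1 = y1 by apply: homog_uniq => //; apply: homogN.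
by rewrite -superproj0; apply/superproj_eq; rewrite subr0 E0.
Qed.
HB.instance Definition _ := Algebra_isSuperalgebra.Build K superquot
  quot_homog0 quot_homog1 quot_homog_lin quot_homogM
  quot_homog_dec quot_homog_disj.

Lemma superproj_morph : superalg_morph superproj.
Proof.
split=> [k x y||e x hx]; first by rewrite superprojD superprojZ.
- by split=> // x y; rewrite superprojM.
- by exists x.
Qed.

Lemma superproj_rel s : S s -> superproj s = 0.
Proof.
by move=> Ss; rewrite -superproj0; apply/superproj_eq; rewrite subr0;
  apply: ideal_genS.
Qed.

(* The factorization of f, when f is a morphism that vanishes on S. *)
Definition quot_lift (B : superalgType K) (f : A -> B) (x : superquot) : B :=
  f (repr x).

Section Lift.
Variables (B : superalgType K) (f : A -> B).
Hypotheses (fP : superalg_morph f) (fS : forall s, S s -> f s = 0).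

Lemma quot_liftE x : quot_lift f (superproj x) = f x.
Proof.
apply/eqP; rewrite -subr_eq0 -(morphS_B fP); apply/eqP/(ideal_gen_morph fP fS).
exact: repr_superproj.
Qed.

Lemma quot_lift_morph : superalg_morph (quot_lift f).
Proof.
split=> [k||e _ [x hx ->]].
- elim/quot_ind=> x; elim/quot_ind=> y.
  by rewrite -superprojZ -superprojD !quot_liftE (morphS_D fP) (morphS_Z fP).
- split; first by rewrite -superproj1 quot_liftE (morphS_1 fP).
  elim/quot_ind=> x; elim/quot_ind=> y.
  by rewrite -superprojM !quot_liftE (morphS_M fP).
- by rewrite quot_liftE; apply: (morphS_homog fP).
Qed.

End Lift.

End Quotient.

Section ComQuotient.
Variables (K : fieldType) (A : comSuperalgType K) (S : homset A).

Fact quot_supermulrC d e (x y : superquot S) : homog d x -> homog e y ->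
  x * y = (-1) ^+ (d && e) * (y * x).
Proof.
move=> [x' hx ->] [y' hy ->].
rewrite -(morphS_sign (superproj_morph S)) -!superprojM.
by rewrite (supermulrC hx hy).
Qed.
HB.instance Definition _ :=
  Superalgebra_isCommutative.Build K (superquot S) quot_supermulrC.

End ComQuotient.

Lemma malg_scaleU (K : fieldType) (G : choiceType) (k : K) (w : {fmonom G}) :
  << k *g w >> = k *: << w >> :> {malg K[{fmonom G}]}.
Proof. by apply/malgP=> v; rewrite mcoeffZ !mcoeffU mulr_natr. Qed.

(* The free associative algebra on G; par matters only for its grading. *)
Definition freeAlg (K : fieldType) (G : choiceType) (par : G -> bool) : Type :=
  {malg K[{fmonom G}]}.

Section FreeAlgebra.
Variables (K : fieldType) (G : choiceType) (par : G -> bool).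
Local Notation freeAlg := (freeAlg K par).

HB.instance Definition _ := GRing.Lalgebra.on freeAlg.

Definition word_parity (w : {fmonom G}) : bool := odd (count par w).

Definition freeAlg_homog (e : bool) : set freeAlg :=
  [set f | forall w, f@_w != 0 -> word_parity w = e]%classic.

Definition freeAlg_gen (g : G) : freeAlg := << fmu g >>.

Lemma word_parityM v w :
  word_parity (mmul v w) = word_parity v (+) word_parity w.
Proof. by rewrite /word_parity fmM count_cat oddD. Qed.

Fact freeAlg_scalerAr (k : K) (x y : freeAlg) : k *: (x * y) = x * (k *: y).
Proof.
apply/malgP=> w; rewrite mcoeffZ mcoeffMl.
rewrite (mcoeffMlw _ (fsubset_refl _) (msuppZ_le k y)) mulr_sumr.
apply: eq_bigr => u _; rewrite mulr_sumr; apply: eq_bigr => v _.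
by rewrite mcoeffZ mulrnAr mulrCA.
Qed.
HB.instance Definition _ :=
  GRing.Lalgebra_isAlgebra.Build K freeAlg freeAlg_scalerAr.

Fact freeAlg_homog0 e : freeAlg_homog e 0.
Proof. by move=> w; rewrite mcoeff0 eqxx. Qed.
Fact freeAlg_homog1 : freeAlg_homog false 1.
Proof.
move=> w; rewrite mcoeff1; case: (eqVneq w mone) => [-> _|_].
  by rewrite /word_parity fm1.
by rewrite eqxx.
Qed.
Fact freeAlg_homog_lin e (k : K) x y :
  freeAlg_homog e x -> freeAlg_homog e y -> freeAlg_homog e (k *: x + y).
Proof.
move=> hx hy w; rewrite mcoeffD mcoeffZ.
have [x0|/hx //] := eqVneq x@_w 0; have [y0|/hy //] := eqVneq y@_w 0.
by rewrite x0 y0 mulr0 addr0 eqxx.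
Qed.
Fact freeAlg_homogM d e x y :
  freeAlg_homog d x -> freeAlg_homog e y -> freeAlg_homog (d (+) e) (x * y).
Proof.
move=> hx hy w; rewrite mcoeff_neq0 => /msuppM_le[u [v []]].
by rewrite -!mcoeff_neq0 => /hx <- /hy <- ->; rewrite word_parityM.
Qed.
Fact freeAlg_homog_dec x : exists2 x0, freeAlg_homog false x0 &
  exists2 x1, freeAlg_homog true x1 & x = x0 + x1.
Proof.
have h e : freeAlg_homog e
    (\sum_(w <- msupp x | word_parity w == e) << x@_w *g w >>).
  elim/big_ind: _ => [|u v hu hv|w /eqP we v].
  - exact: freeAlg_homog0.
  - by rewrite -[u]scale1r; apply: freeAlg_homog_lin.
  - by rewrite mcoeffU; case: (eqVneq w v) => [<-|_ /eqP].
exists (\sum_(w <- msupp x | word_parity w == false) << x@_w *g w >>).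
  exact: h.
exists (\sum_(w <- msupp x | word_parity w == true) << x@_w *g w >>).
  exact: h.
rewrite {1}[x]monalgE (bigID (fun w => word_parity w == false)) /=.
by congr (_ + _); apply: eq_bigl => w; case: word_parity.
Qed.
Fact freeAlg_homog_disj x :
  freeAlg_homog false x -> freeAlg_homog true x -> x = 0.
Proof.
move=> h0 h1; apply/malgP=> w; rewrite mcoeff0; apply/eqP.
by apply/negP=> /negP h; move: (h1 w h); rewrite (h0 w h).
Qed.
HB.instance Definition _ := Algebra_isSuperalgebra.Build K freeAlg
  freeAlg_homog0 freeAlg_homog1 freeAlg_homog_lin freeAlg_homogM
  freeAlg_homog_dec freeAlg_homog_disj.

Lemma freeAlg_gen_homog g : homog (par g) (freeAlg_gen g).
Proof.
move=> w; rewrite mcoeffU; case: (eqVneq (fmu g) w) => [<- _|_ /eqP //].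
by rewrite /word_parity fmU /= addn0 oddb.
Qed.

Section Eval.
Variables (B : superalgType K) (b : G -> B).

Definition word_eval (w : {fmonom G}) : B := \prod_(g <- w) b g.

Definition freeAlg_eval (f : freeAlg) : B := mmap (in_alg B) word_eval f.

Fact word_eval_mmorph : mmorphism word_eval.
Proof.
by split=> [v w|]; rewrite /word_eval ?fmM ?big_cat // fm1 big_nil.
Qed.
HB.instance Definition _ :=
  monalg.isMultiplicative.Build {fmonom G} B word_eval word_eval_mmorph.

Lemma freeAlg_evalE g : freeAlg_eval (freeAlg_gen g) = b g.
Proof.
by rewrite /freeAlg_eval mmapU /= scale1r mul1r /word_eval fmU big_seq1.
Qed.

Lemma freeAlg_eval_morph : (forall g, homog (par g) (b g)) ->
  superalg_morph freeAlg_eval.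
Proof.
move=> hb; split=> [k x y||e x hx].
- by rewrite /freeAlg_eval mmapD mmapZ /= mulr_algl.
- have comm (f : freeAlg) u v : GRing.comm (in_alg B f@_u) (word_eval v).
    by rewrite /GRing.comm /= mulr_algl mulr_algr.
  have [hM h1] := commr_mmap_is_multiplicative comm.
  by split=> // x y; apply: hM.
- rewrite /freeAlg_eval mmapE big_seq; apply: homog_sum => w.
  rewrite -mcoeff_neq0 => /hx <-; rewrite /= mulr_algl; apply: homogZ.
  rewrite /word_eval /word_parity; elim: (w : seq G) => [|g v IH].
    by rewrite big_nil; apply: homog1.
  by rewrite big_cons /= oddD oddb; apply: homogM.
Qed.

Lemma freeAlg_eval_uniq (f : freeAlg -> B) : superalg_morph f ->
  (forall g, f (freeAlg_gen g) = b g) -> f =1 freeAlg_eval.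
Proof.
move=> fP fb x; rewrite {1}[x]monalgE (morphS_sum fP); apply: eq_bigr => w _.
have -> : << x@_w *g w >> = x@_w *: (<< w >> : freeAlg).
  exact: malg_scaleU.
rewrite (morphS_Z fP) /= mulr_algl; congr (_ *: _).
rewrite /word_eval; case: w => w /=; elim: w => [|g w IH].
  rewrite big_nil -(morphS_1 fP); congr (f << _ >>); apply: val_inj.
  by rewrite /= fm1.
rewrite big_cons -IH -fb -(morphS_M fP) /freeAlg_gen; congr f.
have -> : FMonom (g :: w) = mmul (fmu g) (FMonom w).
  by apply: val_inj; rewrite /= fmM fmU.
by rewrite [RHS]malgM_def fgmulUU mulr1.
Qed.


End Eval.
End FreeAlgebra.

(* The field K, concentrated in parity false. *)
Section BaseField.
Variable K : fieldType.

Definition base_homog (e : bool) : set K^o := [set x | e -> x = 0]%classic.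

Fact base_homog0 e : base_homog e 0. Proof. by []. Qed.
Fact base_homog1 : base_homog false 1. Proof. by []. Qed.
Fact base_homog_lin e (k : K) x y :
  base_homog e x -> base_homog e y -> base_homog e (k *: x + y).
Proof. by move=> hx hy he; rewrite hx // hy // scaler0 addr0. Qed.
Fact base_homogM d e x y :
  base_homog d x -> base_homog e y -> base_homog (d (+) e) (x * y).
Proof.
move=> hx hy; case: d hx => hx /= he; first by rewrite hx // mul0r.
by rewrite hy // mulr0.
Qed.
Fact base_homog_dec x : exists2 x0, base_homog false x0 &
  exists2 x1, base_homog true x1 & x = x0 + x1.
Proof. by exists x => //; exists 0; rewrite ?addr0. Qed.
Fact base_homog_disj x : base_homog false x -> base_homog true x -> x = 0.
Proof. by move=> _; apply. Qed.
HB.instance Definition _ := Algebra_isSuperalgebra.Build K K^o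
  base_homog0 base_homog1 base_homog_lin base_homogM
  base_homog_dec base_homog_disj.
Fact base_supermulrC d e (x y : K^o) : homog d x -> homog e y ->
  x * y = (-1) ^+ (d && e) * (y * x).
Proof.
case: d => hx; last by rewrite expr0 mul1r mulrC.
by rewrite hx // mul0r mulr0 mulr0.
Qed.
HB.instance Definition _ :=
  Superalgebra_isCommutative.Build K K^o base_supermulrC.

End BaseField.

Section SignRule.
Variables (G : choiceType) (par : G -> bool) (A : nzRingType) (x : G -> A).
Hypothesis xC : forall g h, x g * x h = (-1) ^+ (par g && par h) * (x h * x g).

Lemma sign_rule_letter g (v : seq G) : x g * (\prod_(h <- v) x h) =
  (-1) ^+ (par g && odd (count par v)) * ((\prod_(h <- v) x h) * x g).
Proof.
elim: v => [|h v IH]; first by rewrite big_nil andbF !mul1r mulr1.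
rewrite big_cons mulrA xC -!mulrA IH /= oddD oddb !mulr_sign.
by case: (par g); case: (par h); case: (odd _); rewrite /= ?mulrN ?opprK.
Qed.

Lemma sign_rule_word (u v : seq G) :
  (\prod_(g <- u) x g) * (\prod_(g <- v) x g) =
  (-1) ^+ (odd (count par u) && odd (count par v)) *
  ((\prod_(g <- v) x g) * (\prod_(g <- u) x g)).
Proof.
elim: u => [|g u IH]; first by rewrite big_nil !mul1r mulr1.
have E := sign_rule_letter g v.
have F V U (s t : bool) : x g * V = (-1) ^+ s * (V * x g) ->
    x g * ((-1) ^+ t * (V * U)) = (-1) ^+ (s (+) t) * (V * (x g * U)).
  rewrite !mulr_sign => EV.
  by case: t; case: s EV => /= EV; rewrite ?mulrN (mulrA (x g) V U) EV ?mulNr ?opprK -mulrA.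
rewrite big_cons -mulrA IH (F _ _ _ _ E) /= oddD oddb.
by case: (par g); case: (odd _); case: (odd _).
Qed.

End SignRule.

Lemma sign_rule_sum (K : fieldType) (A : algType K) (W : eqType) (x : W -> A)
    (par : W -> bool) (s t : seq W) (a b : W -> K) (d e : bool) :
  (forall u v, x u * x v = (-1) ^+ (par u && par v) * (x v * x u)) ->
  (forall u, u \in s -> par u = d) -> (forall u, u \in t -> par u = e) ->
  (\sum_(u <- s) a u *: x u) * (\sum_(v <- t) b v *: x v) =
  (-1) ^+ (d && e) *
  ((\sum_(v <- t) b v *: x v) * (\sum_(u <- s) a u *: x u)).
Proof.
move=> xC hs ht; rewrite !big_distrlr /= [in RHS]exchange_big /= mulr_sumr.
apply: eq_big_seq => u /hs <-; rewrite mulr_sumr.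
apply: eq_big_seq => v /ht <-.
rewrite -!scalerAl -!scalerAr xC !mulr_sign.
by case: ifP; rewrite ?scalerN scalerA mulrC -scalerA.
Qed.

Section FreeSuperalgebra.
Variables (K : fieldType) (G : choiceType) (par : G -> bool).

Local Notation fgen := (@freeAlg_gen K G par).

Definition aug_gen (g : G) : K^o := if par g then 0 else 1.

Lemma aug_gen_homog g : homog (par g) (aug_gen g).
Proof. by rewrite /aug_gen; case: (par g). Qed.

Inductive supercommutator : freeAlg K par -> Prop :=
| Supercommutator g h : supercommutator
    (fgen g * fgen h - (-1) ^+ (par g && par h) * (fgen h * fgen g)).

Fact supercommutator_homog s : supercommutator s -> exists e, homog e s.
Proof.
case=> g h; exists (par g (+) par h); apply: homogB.
  by apply: homogM; apply: freeAlg_gen_homog.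
rewrite -[_ (+) _]addFb; apply: homogM; first exact: homog_sign.
by rewrite addbC; apply: homogM; apply: freeAlg_gen_homog.
Qed.

Lemma supercommutator_kill (B : comSuperalgType K) (b : G -> B) s :
  (forall g, homog (par g) (b g)) ->
  supercommutator s -> freeAlg_eval b s = 0.
Proof.
move=> hb [g h]; have fP := freeAlg_eval_morph hb.
rewrite (morphS_supercomm fP) 2!freeAlg_evalE.
by rewrite (supermulrC (hb g) (hb h)) subrr.
Qed.

Fact supercommutator_proper : ~ ideal_gen supercommutator 1.
Proof.
apply: (ideal_gen_proper (freeAlg_eval_morph aug_gen_homog)) => s.
exact: (supercommutator_kill aug_gen_homog).
Qed.

Definition supercommutators : homset (freeAlg K par) :=
  Homset supercommutator_homog supercommutator_proper.

(* The free commutative superalgebra on G, in which g has parity par g. *)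
Definition freeSuperalg : Type := superquot supercommutators.
HB.instance Definition _ := Superalgebra.on freeSuperalg.

Definition free_gen (g : G) : freeSuperalg := superproj _ (fgen g).

Lemma free_gen_homog g : homog (par g) (free_gen g).
Proof. by apply: (morphS_homog (superproj_morph _)); apply: freeAlg_gen_homog. Qed.

Lemma free_genC g h : free_gen g * free_gen h =
  (-1) ^+ (par g && par h) * (free_gen h * free_gen g).
Proof.
have pP := superproj_morph supercommutators.
have /(superproj_rel (S := supercommutators)) := Supercommutator g h.
rewrite (morphS_supercomm pP) => /eqP.
by rewrite subr_eq0 => /eqP.
Qed.

Lemma free_word_proj (w : {fmonom G}) :
  superproj supercommutators << w >> = \prod_(g <- w) free_gen g.
Proof.
have pP := superproj_morph supercommutators.
have fb g : superproj supercommutators (fgen g) = free_gen g by [].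
by rewrite (freeAlg_eval_uniq pP fb) /freeAlg_eval mmapU /= scale1r mul1r.
Qed.

Fact free_supermulrC d e (x y : freeSuperalg) : homog d x -> homog e y ->
  x * y = (-1) ^+ (d && e) * (y * x).
Proof.
have pP := superproj_morph supercommutators.
have h c (z : freeSuperalg) : homog c z -> exists2 f : freeAlg K par,
    z = \sum_(w <- msupp f) f@_w *: \prod_(g <- w) free_gen g &
    forall w, w \in msupp f -> odd (count par w) = c.
  move=> [f hf ->]; exists f; last by move=> w; rewrite -mcoeff_neq0 => /hf.
  rewrite {1}[f]monalgE (morphS_sum pP); apply: eq_bigr => w _.
  rewrite -free_word_proj -(morphS_Z pP); congr superproj.
  exact: malg_scaleU.
move=> /h[f -> hf] /h[f' -> hf'].
apply: (sign_rule_sum _ _ _ hf hf') => u v.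
exact: (sign_rule_word free_genC).
Qed.
HB.instance Definition _ :=
  Superalgebra_isCommutative.Build K freeSuperalg free_supermulrC.

Section Eval.
Variables (B : comSuperalgType K) (b : G -> B).

(* The morphism that sends g to b g, when b g has parity par g for all g. *)
Definition free_eval : freeSuperalg -> B := quot_lift (freeAlg_eval b).

Hypothesis hb : forall g, homog (par g) (b g).

Lemma free_evalE g : free_eval (free_gen g) = b g.
Proof.
rewrite [LHS]quot_liftE ?freeAlg_evalE //; first exact: freeAlg_eval_morph.
by move=> s; apply: supercommutator_kill.
Qed.

Lemma free_eval_morph : superalg_morph free_eval.
Proof.
apply: quot_lift_morph; first exact: freeAlg_eval_morph.
by move=> s; apply: supercommutator_kill.
Qed.

Lemma free_eval_uniq (f : freeSuperalg -> B) : superalg_morph f ->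
  (forall g, f (free_gen g) = b g) -> f =1 free_eval.
Proof.
move=> fP fb; elim/quot_ind=> x.
rewrite [RHS]quot_liftE; [|exact: freeAlg_eval_morph|]; last first.
  by move=> s; apply: supercommutator_kill.
exact: (freeAlg_eval_uniq (superalg_morph_comp fP (superproj_morph _)) fb).
Qed.

End Eval.

End FreeSuperalgebra.

Section Localization.
Variables (K : fieldType) (G : choiceType) (par : G -> bool).

(* A second generator for each even g, to serve as its inverse. *)
Definition loc_gens : choiceType := (G + {g : G | ~~ par g})%type.

Definition loc_par (x : loc_gens) : bool :=
  if x is inl g then par g else false.

Local Notation free := (freeSuperalg K loc_par).
Local Notation fgen := (@free_gen K loc_gens loc_par).

Inductive loc_rel : free -> Prop :=
| LocRel (g : {g : G | ~~ par g}) :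
    loc_rel (fgen (inl (val g)) * fgen (inr g) - 1).

Fact loc_rel_homog s : loc_rel s -> exists e, homog e s.
Proof.
case=> g; exists false; apply: homogB; last exact: homog1.
have hl : homog false (fgen (inl (val g))).
  have := @free_gen_homog K _ loc_par (inl (val g)).
  by rewrite /= (negbTE (valP g)).
exact: (homogM hl (@free_gen_homog K _ loc_par (inr g))).
Qed.

Definition loc_subst (B : superalgType K) (b : G -> B) (x : loc_gens) : B :=
  match x with inl g => b g | inr g => sinv (b (val g)) end.

Lemma loc_subst_homog (B : comSuperalgType K) (b : G -> B) x :
  (forall g, homog (par g) (b g)) -> (forall g, ~~ par g -> sunit (b g)) ->
  homog (loc_par x) (loc_subst b x).
Proof.
move=> hb ub; case: x => [g|g] //=; apply: sinv_homog; first exact: ub (valP g).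
by have := hb (val g); rewrite (negbTE (valP g)).
Qed.

Lemma loc_rel_kill (B : comSuperalgType K) (b : G -> B) s :
  (forall g, homog (par g) (b g)) -> (forall g, ~~ par g -> sunit (b g)) ->
  loc_rel s -> free_eval (loc_subst b) s = 0.
Proof.
move=> hb ub [g]; have hs x := loc_subst_homog x hb ub.
have fP := free_eval_morph hs.
rewrite (morphS_B fP) (morphS_M fP) (morphS_1 fP) 2!(free_evalE hs) /=.
by rewrite (sinvP (ub _ (valP g))).1 subrr.
Qed.

Fact loc_rel_proper : ~ ideal_gen loc_rel 1.
Proof.
have hb := @aug_gen_homog K G par.
have ub g : ~~ par g -> sunit (aug_gen K par g).
  by rewrite /aug_gen => /negbTE ->; exists 1; rewrite mulr1.
have hs x := loc_subst_homog x hb ub.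
by apply: (ideal_gen_proper (free_eval_morph hs)) => s; apply: loc_rel_kill.
Qed.

Definition loc_rels : homset free := Homset loc_rel_homog loc_rel_proper.

(* The localization of freeSuperalg K par at all its even generators; the
   universal property is loc_universal. *)
Definition locSuperalg : Type := superquot loc_rels.
HB.instance Definition _ := ComSuperalgebra.on locSuperalg.

Definition loc_gen (g : G) : locSuperalg := superproj loc_rels (fgen (inl g)).

Lemma loc_gen_homog g : homog (par g) (loc_gen g).
Proof.
apply: (morphS_homog (superproj_morph loc_rels)).
exact: (@free_gen_homog K _ loc_par (inl g)).
Qed.

Lemma loc_gen_inv (g : {g : G | ~~ par g}) :
  loc_gen (val g) * superproj loc_rels (fgen (inr g)) = 1.
Proof.
have pP := superproj_morph loc_rels.
have /(superproj_rel (S := loc_rels)) := LocRel g.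
rewrite (morphS_B pP) (morphS_M pP) (morphS_1 pP) => /eqP.
by rewrite subr_eq0 => /eqP.
Qed.

Lemma even_comm (B : comSuperalgType K) (x y : B) :
  homog false x -> x * y = y * x.
Proof.
move=> hx; have [y0 h0 [y1 h1 ->]] := homog_dec y.
by rewrite mulrDr mulrDl (supermulrC hx h0) (supermulrC hx h1) !mul1r.
Qed.

Lemma loc_gen_unit g : ~~ par g -> sunit (loc_gen g).
Proof.
move=> eg; exists (superproj loc_rels (fgen (inr (Sub g eg)))).
have E : loc_gen g * superproj loc_rels (fgen (inr (Sub g eg))) = 1.
  exact: loc_gen_inv (Sub g eg).
split; first exact: E.
have hg : homog false (loc_gen g) by have := loc_gen_homog g; rewrite (negbTE eg).
by rewrite -(even_comm _ hg).
Qed.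

Section Eval.
Variables (B : comSuperalgType K) (b : G -> B).

(* The morphism that sends g to b g, when b g has parity par g for all g and is
   invertible for all even g. *)
Definition loc_eval : locSuperalg -> B := quot_lift (free_eval (loc_subst b)).

Hypothesis hb : forall g, homog (par g) (b g).
Hypothesis ub : forall g, ~~ par g -> sunit (b g).

Let hs x := loc_subst_homog x hb ub.
Let fP := free_eval_morph hs.
Let fS s := @loc_rel_kill B b s hb ub.

Lemma loc_eval_morph : superalg_morph loc_eval.
Proof. exact: (quot_lift_morph (S := loc_rels) fP fS). Qed.

Lemma loc_evalE g : loc_eval (loc_gen g) = b g.
Proof. by rewrite [LHS](quot_liftE (S := loc_rels) fP fS) (free_evalE hs). Qed.

Lemma loc_eval_uniq (f : locSuperalg -> B) : superalg_morph f ->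
  (forall g, f (loc_gen g) = b g) -> f =1 loc_eval.
Proof.
move=> gP gb; elim/quot_ind=> x; rewrite [RHS](quot_liftE (S := loc_rels) fP fS).
have pP := superproj_morph loc_rels.
apply: (free_eval_uniq hs (superalg_morph_comp gP pP)) => -[g|g] /=.
  exact: gb.
have ug := loc_gen_unit (valP g).
have [_] := morphS_sinv gP ug; rewrite gb => <-; congr f.
apply/esym/sinv_eq; first exact: loc_gen_inv.
have hg : homog false (loc_gen (val g)).
  by have := loc_gen_homog (val g); rewrite (negbTE (valP g)).
by rewrite -(even_comm _ hg); apply: loc_gen_inv.
Qed.

End Eval.

Definition loc_map : freeSuperalg K par -> locSuperalg := free_eval loc_gen.

Lemma loc_universal (B : comSuperalgType K) (f : freeSuperalg K par -> B) :
  superalg_morph f ->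
  (forall g, ~~ par g -> sunit (f (free_gen K par g))) ->
  exists f' : locSuperalg -> B,
    [/\ superalg_morph f', f' \o loc_map =1 f &
        forall f'', superalg_morph f'' -> f'' \o loc_map =1 f -> f'' =1 f'].
Proof.
move=> fP ub; pose b g := f (free_gen K par g).
have hb g : homog (par g) (b g) by apply/(morphS_homog fP)/free_gen_homog.
have lP := free_eval_morph loc_gen_homog.
exists (loc_eval b); split=> [||f'' gP gf].
- exact: loc_eval_morph.
- move=> x; rewrite (free_eval_uniq hb fP (fun g => erefl)).
  apply: (free_eval_uniq hb (superalg_morph_comp (loc_eval_morph hb ub) lP)).
  by move=> g; rewrite /= (free_evalE loc_gen_homog) loc_evalE.
- apply: (loc_eval_uniq hb ub gP) => g.
  by rewrite /b -gf /= /loc_map (free_evalE loc_gen_homog).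
Qed.

End Localization.

Section Subsuperalgebra.
Variables (K : fieldType) (A : superalgType K).

Record subsuperalg := Subsuperalg {
  subsuper_set :> A -> Prop;
  subsuper1 : subsuper_set 1;
  subsuper_lin : forall (k : K) x y,
    subsuper_set x -> subsuper_set y -> subsuper_set (k *: x + y);
  subsuperM : forall x y,
    subsuper_set x -> subsuper_set y -> subsuper_set (x * y);
  subsuper_dec : forall x, subsuper_set x -> exists x0 x1,
    [/\ subsuper_set x0, subsuper_set x1, homog false x0, homog true x1 &
        x = x0 + x1]
}.

Variable S : subsuperalg.

(* S as a superalgebra of its own. *)
Record subsuper_sort := Subsuper {
  subsuper_val : A;
  subsuper_valP : `[< S subsuper_val >]
}.

HB.instance Definition _ := [isSub for subsuper_val].
HB.instance Definition _ := [Choice of subsuper_sort by <:].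

Definition subsuper_pred : {pred A} := fun x => `[< S x >].

Fact subsuper_closed : subalg_closed subsuper_pred.
Proof.
split=> [|k x y|x y]; rewrite !unfold_in.
- by apply/asboolP; apply: subsuper1.
- by move=> /asboolP hx /asboolP hy; apply/asboolP; apply: subsuper_lin.
- by move=> /asboolP hx /asboolP hy; apply/asboolP; apply: subsuperM.
Qed.
HB.instance Definition _ := GRing.SubChoice_isSubAlgebra.Build K A
  subsuper_pred subsuper_sort (GRing.subalg_closed_semi subsuper_closed).

Definition subsuper_homog (e : bool) : set subsuper_sort :=
  [set x | homog e (val x)]%classic.

Fact subsuper_homog0 e : subsuper_homog e 0.
Proof. exact: homog0. Qed.
Fact subsuper_homog1 : subsuper_homog false 1.
Proof. exact: homog1. Qed.
Fact subsuper_homog_lin e (k : K) x y :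
  subsuper_homog e x -> subsuper_homog e y -> subsuper_homog e (k *: x + y).
Proof. exact: homog_lin. Qed.
Fact subsuper_homogM d e x y :
  subsuper_homog d x -> subsuper_homog e y -> subsuper_homog (d (+) e) (x * y).
Proof. exact: homogM. Qed.
Fact subsuper_homog_dec x : exists2 x0, subsuper_homog false x0 &
  exists2 x1, subsuper_homog true x1 & x = x0 + x1.
Proof.
have [x0 [x1 [/asboolP s0 /asboolP s1 h0 h1 E]]] :=
  subsuper_dec (asboolW (valP x)).
exists (Subsuper s0) => //; exists (Subsuper s1) => //.
exact: val_inj.
Qed.
Fact subsuper_homog_disj x :
  subsuper_homog false x -> subsuper_homog true x -> x = 0.
Proof. by move=> h0 h1; apply/val_inj/homog_disj. Qed.
HB.instance Definition _ := Algebra_isSuperalgebra.Build K subsuper_sort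
  subsuper_homog0 subsuper_homog1 subsuper_homog_lin subsuper_homogM
  subsuper_homog_dec subsuper_homog_disj.

End Subsuperalgebra.

(* The parity of the index i in a size m|n. *)
Definition ipar (m n : nat) (i : 'I_(m + n)) : bool := (m <= i)%N.

Definition even_supermx (K : fieldType) (A : superalgType K) (m n p q : nat)
    (M : 'M[A]_(m + n, p + q)) : Prop :=
  forall i j, homog (ipar i (+) ipar j) (M i j).

Definition mx11 (A : Type) (a b c d : A) : 'M[A]_(1 + 1) :=
  block_mx (const_mx a) (const_mx b) (const_mx c) (const_mx d).

Section Berezinian.
Variable A : nzRingType.
Implicit Types B : 'M[A]_(1 + 1).

Definition mxa B : A := B (lshift 1 ord0) (lshift 1 ord0).
Definition mxb B : A := B (lshift 1 ord0) (rshift 1 ord0).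
Definition mxc B : A := B (rshift 1 ord0) (lshift 1 ord0).
Definition mxd B : A := B (rshift 1 ord0) (rshift 1 ord0).

(* The two Berezinians, with a given element in the place of the inverse of the
   entry d, respectively a. *)
Definition Ber_with (d' : A) B : A := d' * (mxa B - mxb B * d' * mxc B).
Definition Berstar_with (a' : A) B : A := a' * (mxd B - mxc B * a' * mxb B).

Definition Ber B : A := Ber_with (sinv (mxd B)) B.
Definition Berstar B : A := Berstar_with (sinv (mxa B)) B.

Lemma Ber_with_mx11 d' (a b c d : A) :
  Ber_with d' (mx11 a b c d) = d' * (a - b * d' * c).
Proof.
by rewrite /Ber_with /mxa /mxb /mxc /mx11 block_mxEul block_mxEur block_mxEdl !mxE.
Qed.

Lemma Berstar_with_mx11 a' (a b c d : A) :
  Berstar_with a' (mx11 a b c d) = a' * (d - c * a' * b).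
Proof.
by rewrite /Berstar_with /mxd /mxb /mxc /mx11 block_mxEdr block_mxEur block_mxEdl
  !mxE.
Qed.

End Berezinian.

Lemma homog_Ber (K : fieldType) (A : superalgType K) e e' (x a b c : A) :
  homog false x -> homog e a -> homog e' b -> homog (e (+) e') c ->
  homog e (x * (a - b * x * c)).
Proof.
move=> hx ha hb hc; rewrite -[e]addFb; apply: homogM => //; apply: homogB => //.
by have := homogM (homogM hb hx) hc; rewrite addbF addbC addbK.
Qed.

Lemma morphS_Ber (K : fieldType) (A B : superalgType K) (f : A -> B)
    (u v x a b c : A) : superalg_morph f ->
  f (u * v - x * (a - b * x * c)) =
  f u * f v - f x * (f a - f b * f x * f c).
Proof. by move=> fP; rewrite !(morphS_B fP, morphS_M fP). Qed.

Section SL11.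
Variables (K : numFieldType) (A : comSuperalgType K).

Definition SL11 (g : 'M[A]_(1 + 1)) : Prop :=
  [/\ even_supermx g,
      exists h : 'M[A]_(1 + 1), g *m h = 1%:M /\ h *m g = 1%:M,
      sunit (mxd g) & Ber g = 1].

Definition Mtilde (p q : nat) (M : 'M[A]_(1 + 1, p + q)) : Prop :=
  even_supermx M /\ (forall i j, ~~ (ipar i (+) ipar j) -> sunit (M i j)).

Lemma sunitM (x y : A) : sunit x -> sunit y -> sunit (x * y).
Proof.
move=> [x' [x1 x2]] [y' [y1 y2]]; exists (y' * x'); split.
  by rewrite mulrA -(mulrA x) y1 mulr1.
by rewrite mulrA -(mulrA y') x2 mulr1.
Qed.

Lemma odd_sq (x : A) : homog true x -> x * x = 0.
Proof.
move=> hx; have /eqP := supermulrC hx hx.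
rewrite /= expr1 mulN1r -subr_eq0 opprK -mulr2n -scaler_nat.
by rewrite scaler_eq0 Num.Theory.pnatr_eq0 /= => /eqP.
Qed.

Lemma sunit_1D (x : A) : x * x = 0 -> sunit (1 + x).
Proof.
move=> xx; exists (1 - x); split.
  by rewrite mulrDl mul1r mulrBr mulr1 xx subr0 subrK.
by rewrite mulrBl mul1r mulrDr mulr1 xx addr0 addrK.
Qed.

Lemma sunitD_odd (u x y : A) : sunit u -> homog false u -> homog true x ->
  homog true y -> sunit (u + x * y).
Proof.
move=> uu hu hx hy; have [u1 u2] := sinvP uu.
have hn : homog false (x * y) := homogM hx hy.
have nn : x * y * (x * y) = 0.
  by rewrite mulrA -(mulrA x) (supermulrC hy hx) /= expr1 mulN1r mulrN mulrA
    odd_sq // !mul0r oppr0 mul0r.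
have -> : u + x * y = u * (1 + sinv u * (x * y)).
  by rewrite mulrDr mulr1 (mulrA u) u1 mul1r.
apply: sunitM => //; apply: sunit_1D.
rewrite -(mulrA (sinv u)) (mulrA (x * y)) (even_comm (sinv u) hn).
by rewrite -(mulrA (sinv u) (x * y)) nn !mulr0.
Qed.

Lemma SL11_unit_a g : SL11 g -> sunit (mxa g).
Proof.
move=> [hg _ ud Bg]; have [d1 d2] := sinvP ud.
have hd : homog false (mxd g) := hg (rshift 1 ord0) (rshift 1 ord0).
have hb : homog true (mxb g) := hg (lshift 1 ord0) (rshift 1 ord0).
have hc : homog true (mxc g) := hg (rshift 1 ord0) (lshift 1 ord0).
have -> : mxa g = mxd g + mxb g * sinv (mxd g) * mxc g.
  move: Bg; rewrite /Ber /Ber_with => /(congr1 (fun z => mxd g * z)).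
  by rewrite mulrA d1 mul1r mulr1 => /eqP; rewrite subr_eq => /eqP.
by apply: sunitD_odd => //; apply: (homogM hb (sinv_homog ud hd)).
Qed.

Lemma SL11_act (p q : nat) g (M : 'M[A]_(1 + 1, p + q)) :
  SL11 g -> Mtilde M -> Mtilde (g *m M).
Proof.
move=> hg [hM uM]; have ua := SL11_unit_a hg; case: hg => hg _ ud _.
have hh i k j : homog (ipar i (+) ipar j) (g i k * M k j).
  by have := homogM (hg i k) (hM k j); rewrite addbA addbK.
split=> i j; first by rewrite mxE; apply: homog_sum => k _; apply: hh.
rewrite -(splitK i) mxE big_split_ord /= !big_ord1.
case: (split i) => i0 /=; rewrite ord1 => e.
  apply: sunitD_odd.
  - by apply: sunitM => //; apply: uM.
  - by rewrite -(negbTE e).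
  - exact: (hg (lshift 1 ord0) (rshift 1 ord0)).
  - by have := hM (rshift 1 ord0) j; move: e; rewrite /ipar /=; case: (p <= j)%N.
rewrite addrC; apply: sunitD_odd.
- by apply: sunitM => //; apply: uM.
- have := hh (rshift 1 ord0) (rshift 1 ord0) j.
  by move: e; rewrite /ipar /=; case: (p <= j)%N.
- exact: (hg (rshift 1 ord0) (lshift 1 ord0)).
- by have := hM (lshift 1 ord0) j; move: e; rewrite /ipar /=; case: (p <= j)%N.
Qed.

End SL11.

Section Invariants.
Variables (K : numFieldType) (p q : nat).

Definition entry : finType := ('I_(1 + 1) * 'I_(p + q))%type.

Definition entry_par (x : entry) : bool := ipar x.1 (+) ipar x.2.

(* The even generators are the entries x_{1j} and x_{1^ mu^} of the diagonal
   blocks. *)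
Definition Otilde : Type := locSuperalg K entry_par.
HB.instance Definition _ := ComSuperalgebra.on Otilde.

Definition Xgeneric : 'M[Otilde]_(1 + 1, p + q) :=
  \matrix_(i, j) loc_gen K entry_par (i, j).

(* The value f(M), when M satisfies Mtilde. *)
Definition subst (A : comSuperalgType K) (M : 'M[A]_(1 + 1, p + q))
    (f : Otilde) : A :=
  loc_eval (fun x : entry => M x.1 x.2) f.

Lemma subst_morph (A : comSuperalgType K) (M : 'M[A]_(1 + 1, p + q)) :
  Mtilde M -> superalg_morph (subst M).
Proof. by move=> [h u]; apply: loc_eval_morph => // x; [apply: h|apply: u]. Qed.

Definition SL_invariant (f : Otilde) : Prop :=
  forall (A : comSuperalgType K) (g : 'M[A]_(1 + 1)) (M : 'M[A]_(1 + 1, p + q)),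
    SL11 g -> Mtilde M -> subst (g *m M) f = subst M f.

Fact SL_invariant1 : SL_invariant 1.
Proof.
move=> A g M hg hM; rewrite (morphS_1 (subst_morph hM)).
by rewrite (morphS_1 (subst_morph (SL11_act hg hM))).
Qed.

Fact SL_invariant_lin (k : K) x y :
  SL_invariant x -> SL_invariant y -> SL_invariant (k *: x + y).
Proof.
move=> hx hy A g M hg hM; have P1 := subst_morph hM.
have P2 := subst_morph (SL11_act hg hM).
rewrite (morphS_D P1) (morphS_D P2) (morphS_Z P1) (morphS_Z P2).
by rewrite hx // hy.
Qed.

Fact SL_invariantM x y :
  SL_invariant x -> SL_invariant y -> SL_invariant (x * y).
Proof.
move=> hx hy A g M hg hM; have P1 := subst_morph hM.
have P2 := subst_morph (SL11_act hg hM).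
by rewrite (morphS_M P1) (morphS_M P2) hx // hy.
Qed.

Fact SL_invariant_dec x : SL_invariant x -> exists x0 x1,
  [/\ SL_invariant x0, SL_invariant x1, homog false x0, homog true x1 &
      x = x0 + x1].
Proof.
move=> hx; have [x0 h0 [x1 h1 E]] := homog_dec x.
have H (A : comSuperalgType K) (g : 'M[A]_(1 + 1))
    (M : 'M[A]_(1 + 1, p + q)) : SL11 g -> Mtilde M ->
    subst (g *m M) x0 = subst M x0 /\ subst (g *m M) x1 = subst M x1.
  move=> hg hM; have P1 := subst_morph hM.
  have P2 := subst_morph (SL11_act hg hM).
  apply: homog_uniq; do ?[exact: morphS_homog].
  by rewrite -(morphS_D P1) -(morphS_D P2) -E hx.
by exists x0, x1; split=> // A g M hg hM; have [] := H A g M hg hM.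
Qed.

Definition SL_invariants : subsuperalg Otilde :=
  Subsuperalg SL_invariant1 SL_invariant_lin SL_invariantM SL_invariant_dec.

Definition evencol (i : 'I_p) : 'cV[Otilde]_(1 + 1) :=
  col (lshift q i) Xgeneric.
Definition oddcol (mu : 'I_q) : 'cV[Otilde]_(1 + 1) :=
  col (rshift p mu) Xgeneric.

Definition superminor (i : 'I_p) (mu : 'I_q) : Otilde :=
  Ber (row_mx (evencol i) (oddcol mu)).
Definition superminor_star (i : 'I_p) (mu : 'I_q) : Otilde :=
  Berstar (row_mx (evencol i) (oddcol mu)).
Definition fake_superminor (mu nu : 'I_q) : Otilde :=
  Ber (row_mx (oddcol mu) (oddcol nu)).
Definition fake_superminor_star (i j : 'I_p) : Otilde :=
  Berstar (row_mx (evencol i) (evencol j)).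

End Invariants.

(* The names of the variables Y_{i|mu}, Y_{mu|nu}, Y*_{i|mu} and Y*_{i|j}. *)
Inductive Yvar (p q : nat) : Type :=
| Yev of 'I_p & 'I_q
| Yod of 'I_q & 'I_q
| Ysev of 'I_p & 'I_q
| Ysod of 'I_p & 'I_p.

Section Presentation.
Variables (K : fieldType) (p q : nat).

Local Notation code :=
  (('I_p * 'I_q + 'I_q * 'I_q) + ('I_p * 'I_q + 'I_p * 'I_p))%type.

Definition Yvar_code (y : Yvar p q) : code :=
  match y with
  | Yev i mu => inl (inl (i, mu))
  | Yod mu nu => inl (inr (mu, nu))
  | Ysev i mu => inr (inl (i, mu))
  | Ysod i j => inr (inr (i, j))
  end.

Definition Yvar_decode (c : code) : Yvar p q :=
  match c with
  | inl (inl (i, mu)) => Yev i mu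
  | inl (inr (mu, nu)) => Yod p mu nu
  | inr (inl (i, mu)) => Ysev i mu
  | inr (inr (i, j)) => Ysod q i j
  end.

Fact Yvar_codeK : cancel Yvar_code Yvar_decode. Proof. by case. Qed.
HB.instance Definition _ := Choice.copy (Yvar p q) (can_type Yvar_codeK).

Definition Yvar_par (y : Yvar p q) : bool :=
  match y with Yod _ _ | Ysod _ _ => true | _ => false end.

Definition freeY : Type := freeSuperalg K Yvar_par.
HB.instance Definition _ := ComSuperalgebra.on freeY.

Local Notation gen := (@free_gen K (Yvar p q) Yvar_par).

Definition Y (i : 'I_p) (mu : 'I_q) : freeY := gen (Yev i mu).
Definition Yfake (mu nu : 'I_q) : freeY := gen (Yod p mu nu).
Definition Ystar (i : 'I_p) (mu : 'I_q) : freeY := gen (Ysev i mu).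
Definition Ystar_fake (i j : 'I_p) : freeY := gen (Ysod q i j).

(* Each relation is written as a difference that is set to 0. *)
Inductive super_plucker : freeY -> Prop :=
| Plucker_inv i mu : super_plucker (Y i mu * Ystar i mu - 1)
| Plucker_even i j mu nu : super_plucker
    (Y i mu * Y j nu -
     Ber_with (Y i nu)
       (mx11 (Y j mu)         (Yfake nu mu)
             (Ystar_fake i j) (Ystar i nu)))
| Plucker_fake i mu nu la : super_plucker
    (Y i mu * Yfake la nu -
     Ber_with (Y i nu)
       (mx11 (Yfake la mu) (Yfake nu mu)
             (Ystar i la)  (Ystar i nu)))
| Plucker_star_fake i j k mu : super_plucker
    (Ystar i mu * Ystar_fake j k -
     Berstar_with (Ystar j mu)
       (mx11 (Y j mu)         (Y k mu)
             (Ystar_fake i j) (Ystar_fake i k))).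

Fact super_plucker_homog s : super_plucker s -> exists e, homog e s.
Proof.
have hg y := @free_gen_homog K (Yvar p q) Yvar_par y.
have hY i mu : homog false (Y i mu) := hg (Yev i mu).
have hYf mu nu : homog true (Yfake mu nu) := hg (Yod p mu nu).
have hYs i mu : homog false (Ystar i mu) := hg (Ysev i mu).
have hYsf i j : homog true (Ystar_fake i j) := hg (Ysod q i j).
case=> [i mu|i j mu nu|i mu nu la|i j k mu].
- exists false; apply: homogB; last exact: homog1.
  exact: (homogM (hY i mu) (hYs i mu)).
- exists false; rewrite Ber_with_mx11; apply: homogB.
    exact: (homogM (hY i mu) (hY j nu)).
  exact: (homog_Ber (hY i nu) (hY j mu) (hYf nu mu) (hYsf i j)).
- exists true; rewrite Ber_with_mx11; apply: homogB.
    exact: (homogM (hY i mu) (hYf la nu)).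
  exact: (homog_Ber (hY i nu) (hYf la mu) (hYf nu mu) (hYs i la)).
- exists true; rewrite Berstar_with_mx11; apply: homogB.
    exact: (homogM (hYs i mu) (hYsf j k)).
  exact: (homog_Ber (hYs j mu) (hYsf i k) (hYsf i j) (hY k mu)).
Qed.

Fact super_plucker_proper : ~ ideal_gen super_plucker 1.
Proof.
have hb := @aug_gen_homog K _ Yvar_par; have fP := free_eval_morph hb.
apply: (ideal_gen_proper fP) => s.
have E y := free_evalE hb y.
case=> [i mu|i j mu nu|i mu nu la|i j k mu].
- by rewrite (morphS_B fP) (morphS_M fP) (morphS_1 fP) !E mulr1 subrr.
- rewrite Ber_with_mx11 (morphS_Ber _ _ _ _ _ _ fP) !E /aug_gen /=.
  by rewrite !mulr0 !mulr1 subr0 mulr1 subrr.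
- rewrite Ber_with_mx11 (morphS_Ber _ _ _ _ _ _ fP) !E /aug_gen /=.
  by rewrite !mul0r !mulr0 subr0 mulr0 subrr.
- rewrite Berstar_with_mx11 (morphS_Ber _ _ _ _ _ _ fP) !E /aug_gen /=.
  by rewrite !mul0r !mulr0 subr0 mulr0 subrr.
Qed.

Definition super_pluckers : homset freeY :=
  Homset super_plucker_homog super_plucker_proper.

(* The quotient of freeY by the ideal I_sp. *)
Definition presented : Type := superquot super_pluckers.
HB.instance Definition _ := ComSuperalgebra.on presented.

End Presentation.

(* Main.v *)
(* Generically there is a unique g in SL(1|1) taking the columns c_1 and c_1^ to
   (X_{1|1^}; 0) and (0; 1). As Ber and Ber* are invariant under g, the other
   columns c of gX are (Ber(c|c_1^); X_{1|1^} Ber*(c_1|c)), so an invariant f,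
   which equals f(gX), is a polynomial in the super minors (the inverses of the
   even entries of gX are again products of super minors). Building the same
   matrix out of the Y's gives a morphism from Otilde to the presented algebra,
   and the Pluecker relations say exactly that the super minors of this matrix
   are the Y's; its restriction to the invariants is thus inverse to Y -> X. *)
Require Import Defs.
From HB Require Import structures.
From mathcomp Require Import all_boot all_order all_algebra.
From mathcomp Require Import boolp reals complex.

Set Implicit Arguments.
Unset Strict Implicit.
Unset Printing Implicit Defensive.

Import GRing.Theory.

Local Open Scope ring_scope.

Local Notation row0 := (lshift 1 ord0 : 'I_(1 + 1)).
Local Notation row1 := (rshift 1 ord0 : 'I_(1 + 1)).

Local Notation evc k := (lshift _ k).
Local Notation odc k := (rshift _ k).

Definition ber (A : nzRingType) (a b c d : A) : A :=
  sinv d * (a - b * sinv d * c).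

Section Columns.
Variables (A : nzRingType) (n : nat) (M : 'M[A]_(1 + 1, n)).

Lemma Ber_cols k l : Ber (row_mx (col k M) (col l M)) =
  ber (M row0 k) (M row0 l) (M row1 k) (M row1 l).
Proof.
by rewrite /Ber /Ber_with /mxa /mxb /mxc /mxd !row_mxEl !row_mxEr !mxE.
Qed.

Lemma Berstar_cols k l : Berstar (row_mx (col k M) (col l M)) =
  ber (M row1 l) (M row1 k) (M row0 l) (M row0 k).
Proof.
by rewrite /Berstar /Berstar_with /mxa /mxb /mxc /mxd !row_mxEl !row_mxEr !mxE.
Qed.

Lemma mulmx_rows (g : 'M[A]_(1 + 1)) i k :
  (g *m M) i k = g i row0 * M row0 k + g i row1 * M row1 k.
Proof. by rewrite mxE big_split_ord /= !big_ord1. Qed.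

End Columns.

Lemma morphS_ber (K : fieldType) (A B : superalgType K) (f : A -> B) a b c d :
  superalg_morph f -> sunit d -> f (ber a b c d) = ber (f a) (f b) (f c) (f d).
Proof.
move=> fP ud; have [_ E] := morphS_sinv fP ud.
by rewrite /ber !(morphS_B fP, morphS_M fP) E.
Qed.

Section SuperRing.
Variables (K : numFieldType) (A : comSuperalgType K).
Implicit Types a b c d e s t u v w x y z : A.

Lemma odd_anti x y : homog true x -> homog true y -> x * y = - (y * x).
Proof. by move=> hx hy; rewrite (supermulrC hx hy) /= expr1 mulN1r. Qed.

Lemma odd_sandwich x y : homog true x -> homog true y -> x * y * x = 0.
Proof.
by move=> hx hy; rewrite (odd_anti hx hy) mulNr -mulrA odd_sq // mulr0 oppr0.
Qed.

Lemma even_mulrACA x y z t : homog false z ->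
  (x * y) * (z * t) = (x * z) * (y * t).
Proof. by move=> hz; rewrite mulrA -(mulrA x) -(even_comm y hz) !mulrA. Qed.

(* An element of SL(1|1) is a product of an upper unitriangular, an even scalar
   and a lower unitriangular matrix; ber is invariant under each of these. *)
Lemma ber_upper t a b c d : sunit d ->
  ber (a + t * c) (b + t * d) c d = ber a b c d.
Proof.
move=> /sinvP[h _]; rewrite /ber !mulrDl -(mulrA t d) h mulr1.
by rewrite opprD addrACA subrr addr0.
Qed.

Lemma sinvM x y : sunit x -> sunit y -> sinv (x * y) = sinv y * sinv x.
Proof.
move=> /sinvP[x1 x2] /sinvP[y1 y2]; apply: sinv_eq.
  by rewrite mulrA -(mulrA x) y1 mulr1.
by rewrite mulrA -(mulrA _ _ x) x2 mulr1.
Qed.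

Lemma ber_scale e a b c d : homog false e -> sunit e -> homog false d ->
  sunit d -> ber (e * a) (e * b) (e * c) (e * d) = ber a b c d.
Proof.
move=> he ue hd ud; rewrite /ber sinvM //; have [e1 e2] := sinvP ue.
have he' := sinv_homog ue he.
have -> : e * b * (sinv d * sinv e) * (e * c) = e * (b * sinv d * c).
  by rewrite !mulrA -(mulrA _ _ e) e2 mulr1.
by rewrite -mulrBr !mulrA -(mulrA _ _ e) e2 mulr1.
Qed.

Lemma sinv_lower s b d : homog true s -> homog true b -> homog false d ->
  sunit d -> sinv (d + s * b) = sinv d * (1 - s * (b * sinv d)).
Proof.
move=> hs hb hd ud; have [d1 d2] := sinvP ud.
have hd' := sinv_homog ud hd.
set b' := b * sinv d; have hb' : homog true b' := homogM hb hd'.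
have -> : d + s * b = (1 + s * b') * d.
  by rewrite mulrDl mul1r /b' -!mulrA d2 mulr1.
have sb0 : (s * b') * (s * b') = 0 by rewrite mulrA odd_sandwich // mul0r.
apply: sinv_eq.
  rewrite mulrA -(mulrA _ d) d1 mulr1.
  by rewrite mulrDl mul1r mulrBr mulr1 sb0 subr0 subrK.
rewrite -(mulrA (sinv d)) (mulrA (1 - _)).
have -> : (1 - s * b') * (1 + s * b') = 1.
  by rewrite mulrBl mul1r mulrDr mulr1 sb0 addr0 addrK.
by rewrite mul1r.
Qed.

Lemma ber_lower s a b c d : homog true s -> homog true b -> homog false d ->
  sunit d -> ber a b (c + s * a) (d + s * b) = ber a b c d.
Proof.
move=> hs hb hd ud; have hd' := sinv_homog ud hd.
rewrite /ber sinv_lower //.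
set b' := b * sinv d; have hb' : homog true b' := homogM hb hd'.
have -> : b * (sinv d * (1 - s * b')) = b'.
  by rewrite mulrA -/b' mulrBr mulr1 mulrA odd_sandwich // subr0.
rewrite -(mulrA (sinv d)); congr (_ * _); clearbody b'.
have -> : a - b' * (c + s * a) = a - b' * c + s * b' * a.
  by rewrite mulrDr (mulrA b') (odd_anti hb' hs) mulNr opprD opprK addrA.
rewrite mulrBl mul1r mulrDr mulrBr !mulrA (odd_sandwich hs hb') !mul0r addr0.
by rewrite -(mulrA s b' b') odd_sq // mulr0 mul0r subr0 addrK.
Qed.

Lemma SL11_mxa (g : 'M[A]_(1 + 1)) : SL11 g ->
  mxa g = mxd g + mxb g * sinv (mxd g) * mxc g.
Proof.
move=> [_ _ ud Bg]; have [d1 _] := sinvP ud.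
move: Bg; rewrite /Ber /Ber_with => /(congr1 (fun z => mxd g * z)).
by rewrite mulrA d1 mul1r mulr1 => /eqP; rewrite subr_eq => /eqP.
Qed.

Section Invariance.
Variable g : 'M[A]_(1 + 1).
Hypothesis gP : SL11 g.

Let hgb : homog true (mxb g).
Proof. by case: gP => h _ _ _; exact: (h row0 row1). Qed.
Let hgc : homog true (mxc g).
Proof. by case: gP => h _ _ _; exact: (h row1 row0). Qed.
Let hgd : homog false (mxd g).
Proof. by case: gP => h _ _ _; exact: (h row1 row1). Qed.
Let ud : sunit (mxd g). Proof. by case: gP. Qed.
Let hgd' := sinv_homog ud hgd.
Let s := sinv (mxd g) * mxc g.
Let t := mxb g * sinv (mxd g).

Let g_bottom x y : mxc g * x + mxd g * y = mxd g * (y + s * x).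
Proof.
have [d1 _] := sinvP ud.
by rewrite mulrDr /s !mulrA d1 mul1r addrC.
Qed.

Let g_top x y : mxa g * x + mxb g * y = mxd g * x + t * (mxd g * (y + s * x)).
Proof.
have [d1 d2] := sinvP ud.
rewrite (SL11_mxa gP) /t mulrA -(mulrA _ _ (mxd g)) d2 mulr1.
by rewrite mulrDl mulrDr /s !mulrA -addrA; congr (_ + _); rewrite addrC.
Qed.

Let hs : homog true s. Proof. exact: (homogM hgd' hgc). Qed.
Let ht : homog true t. Proof. exact: (homogM hgb hgd'). Qed.

Lemma SL11_ber a b c d : homog true b -> homog false d -> sunit d ->
  ber (mxa g * a + mxb g * c) (mxa g * b + mxb g * d)
      (mxc g * a + mxd g * c) (mxc g * b + mxd g * d) = ber a b c d.
Proof.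
move=> hb hd udd; rewrite !g_top !g_bottom.
have u1 : sunit (d + s * b) by apply: sunitD_odd.
have h1 : homog false (d + s * b) by apply: homogD; [|apply: (homogM hs hb)].
rewrite ber_upper; last exact: sunitM.
by rewrite ber_scale // ber_lower.
Qed.

Lemma SL11_ber_star a b c d : homog false a -> homog true c -> sunit a ->
  ber (mxc g * b + mxd g * d) (mxc g * a + mxd g * c)
      (mxa g * b + mxb g * d) (mxa g * a + mxb g * c) = ber d c b a.
Proof.
move=> ha hc uaa; rewrite !g_top !g_bottom.
have h1 : homog true (c + s * a) by apply: homogD; [|apply: (homogM hs ha)].
rewrite ber_lower //; last 3 first.
- exact: (homogM hgd h1).
- exact: (homogM hgd ha).
- exact: sunitM.
by rewrite ber_scale // ber_upper.
Qed.

End Invariance.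

(* After the even entries are factored out as in ber_even_form and ber_odd_form,
   the Pluecker relations for Ber become the identities below between the odd
   ratios a, n, l = sinv d * b and g, h = sinv a * c. *)
Lemma odd_core_split a n g : homog true a -> homog true n -> homog true g ->
  1 - a * g = (1 - n * g) * (1 + (n - a) * g).
Proof.
move=> ha hn hg; have hu : homog true (n - a) by apply: homogB.
rewrite mulrBl mul1r mulrDr mulr1 (mulrA _ (n - a)) -(mulrA n g).
rewrite -(mulrA n) odd_sandwich // mulr0 addr0 mulrBl.
by rewrite addrA addrAC addrK.
Qed.

Lemma odd_core_fake a n l g : homog true a -> homog true n -> homog true l ->
  homog true g ->
  (1 - a * g) * (l - n) =
  (1 - n * g) * ((l - a) - (n - a) * (1 - n * g) * (1 + l * g)).
Proof.
move=> ha hn hl hg; have hw : homog true (l - n) by apply: homogB.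
rewrite (odd_core_split ha hn hg) -!mulrA; congr (_ * _).
have -> : (1 - n * g) * (1 + l * g) = 1 + (l - n) * g.
  rewrite mulrDr mulr1 mulrBl mul1r (mulrA _ l) -!(mulrA n) odd_sandwich //.
  by rewrite mulr0 subr0 mulrBl addrAC addrA.
rewrite mulrDl mul1r (mulrDr _ 1) mulr1 opprD addrA -mulrA.
rewrite (odd_anti hg hw) mulrN.
by rewrite opprB addrA subrK.
Qed.

Lemma odd_core_even a n g h : homog true a -> homog true n -> homog true g ->
  homog true h ->
  (1 - a * g) * (1 - n * h) =
  (1 - n * g) * ((1 - a * h) - (n - a) * (1 - n * g) * (h - g)).
Proof.
move=> ha hn hg hh; rewrite (odd_core_split ha hn hg) -!mulrA; congr (_ * _).
have -> : (1 - n * g) * (h - g) = h - g - n * g * h.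
  by rewrite mulrBl mul1r mulrBr -(mulrA n g g) odd_sq // mulr0 subr0.
set u := n - a; have -> : a * h = n * h - u * h.
  by rewrite -mulrBl /u opprB addrCA subrr addr0.
rewrite !(mulrBr u) mulrDl mul1r (mulrBr _ 1) mulr1.
have -> : u * g * (n * h) = - (u * (n * g * h)).
  by rewrite -mulrA (mulrA g) (odd_anti hg hn) mulNr mulrN.
rewrite !opprD !opprK !addrA; congr (_ + _ + _).
by rewrite addrK.
Qed.

Lemma ber_even_form a b c d : homog false a -> sunit a -> homog false d ->
  sunit d -> ber a b c d = sinv d * a * (1 - sinv d * b * (sinv a * c)).
Proof.
move=> ha ua hd ud; have hd' := sinv_homog ud hd; have [a1 _] := sinvP ua.
rewrite /ber mulrBr mulrBr mulr1 -(mulrA _ a); congr (_ - _ * _).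
rewrite (mulrA a) (even_comm _ ha) -(mulrA _ a) (mulrA a) a1 mul1r.
by rewrite (even_comm b hd').
Qed.

Lemma plucker_scale i i' j n n' m' u v w x y z :
  homog false i -> homog false i' -> homog false j -> homog false m' ->
  homog false n -> homog false n' -> i * i' = 1 -> n * n' = 1 ->
  u * v = w * (x - y * w * z) ->
  (m' * i * u) * (n' * j * v) =
  (n' * i * w) * (m' * j * x - (m' * n * y) * (n' * i * w) * (i' * j * z)).
Proof.
move=> hi hi' hj hm' hn hn' ii nn E.
have h x1 x2 : homog false x1 -> homog false x2 -> homog false (x1 * x2).
  by move=> h1 h2; apply: (homogM h1 h2).
rewrite (even_mulrACA (m' * n)); last exact: h.
rewrite (even_mulrACA (m' * n * _)); last exact: h.
rewrite (mulrA (m' * n)) -(mulrA m' n) nn mulr1.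
rewrite (mulrA (m' * i)) -(mulrA m' i i') ii mulr1.
rewrite -mulrBr (even_mulrACA (m' * i)); last exact: h.
rewrite (even_mulrACA (n' * i)); last exact: h.
rewrite E; congr (_ * _).
by rewrite (even_mulrACA m') // (even_mulrACA n') // (even_comm m' hn').
Qed.

Lemma ber_odd_form a b c d : homog false c -> homog false d -> sunit c ->
  sunit d -> ber a b c d = sinv d * c * (sinv c * a - sinv d * b).
Proof.
move=> hc hd uc ud; have hd' := sinv_homog ud hd; have [c1 c2] := sinvP uc.
rewrite /ber -(mulrA _ c); congr (_ * _).
by rewrite mulrBr mulrA c1 mul1r (even_comm b hd') (even_comm _ hc).
Qed.

Lemma ber_mul_star a b c d : homog false a -> sunit a -> homog true b ->
  homog true c -> homog false d -> sunit d -> ber a b c d * ber d c b a = 1.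
Proof.
move=> ha ua hb hc hd ud; rewrite !ber_even_form //.
have [a1 a2] := sinvP ua; have [d1 d2] := sinvP ud.
have ha' := sinv_homog ua ha; have hd' := sinv_homog ud hd.
have hB : homog true (sinv d * b) := homogM hd' hb.
have hC : homog true (sinv a * c) := homogM ha' hc.
rewrite even_mulrACA; last exact: (homogM ha' hd).
rewrite (mulrA _ _ d) -(mulrA _ a) a1 mulr1 d2 mul1r (odd_anti hC hB) opprK.
move: (_ * b) hB (_ * c) hC => x hx y hy.
rewrite mulrBl mul1r mulrDr mulr1 (mulrA (x * y)) odd_sandwich // mul0r.
by rewrite addr0 addrK.
Qed.

Lemma ber_plucker_even (ai ci aj cj bm dm bn dn : A) :
  homog false ai -> sunit ai -> homog true ci ->
  homog false aj -> sunit aj -> homog true cj ->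
  homog false dm -> sunit dm -> homog true bm ->
  homog false dn -> sunit dn -> homog true bn ->
  ber ai bm ci dm * ber aj bn cj dn =
  ber ai bn ci dn * (ber aj bm cj dm -
    ber bn bm dn dm * ber ai bn ci dn * ber cj ci aj ai).
Proof.
move=> hai uai hci haj uaj hcj hdm udm hbm hdn udn hbn.
have [ai1 ai2] := sinvP uai; have [dn1 dn2] := sinvP udn.
have hai' := sinv_homog uai hai; have haj' := sinv_homog uaj haj.
have hdm' := sinv_homog udm hdm; have hdn' := sinv_homog udn hdn.
rewrite !(ber_even_form _ _ hai) // !(ber_even_form _ _ haj) //.
rewrite !ber_odd_form //.
apply: plucker_scale => //; apply: odd_core_even.
- exact: (homogM hdm' hbm).
- exact: (homogM hdn' hbn).
- exact: (homogM hai' hci).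
- exact: (homogM haj' hcj).
Qed.

(* Exchanging the roles of the even and odd columns, this also covers the
   relation for Y*_{j|k}. *)
Lemma ber_plucker_fake (a c bm dm bn dn bl dl : A) :
  homog false a -> sunit a -> homog true c ->
  homog false dm -> sunit dm -> homog true bm ->
  homog false dn -> sunit dn -> homog true bn ->
  homog false dl -> sunit dl -> homog true bl ->
  ber a bm c dm * ber bl bn dl dn =
  ber a bn c dn * (ber bl bm dl dm -
    ber bn bm dn dm * ber a bn c dn * ber dl c bl a).
Proof.
move=> ha ua hc hdm udm hbm hdn udn hbn hdl udl hbl.
have [a1 a2] := sinvP ua; have [dn1 dn2] := sinvP udn.
have ha' := sinv_homog ua ha; have hdl' := sinv_homog udl hdl.
have hdm' := sinv_homog udm hdm; have hdn' := sinv_homog udn hdn.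
rewrite !(ber_even_form _ _ ha) // (ber_even_form _ _ hdl) // !ber_odd_form //.
have hC : homog true (sinv a * c) := homogM ha' hc.
have hL : homog true (sinv dl * bl) := homogM hdl' hbl.
rewrite (odd_anti hC hL) opprK.
apply: plucker_scale => //; apply: odd_core_fake => //.
- exact: (homogM hdm' hbm).
- exact: (homogM hdn' hbn).
Qed.

End SuperRing.

Section SubsuperCommutative.
Variables (K : fieldType) (A : comSuperalgType K) (S : subsuperalg A).

Fact subsuper_supermulrC d e (x y : subsuper_sort S) :
  homog d x -> homog e y -> x * y = (-1) ^+ (d && e) * (y * x).
Proof.
move=> hx hy; apply: val_inj; rewrite /= (supermulrC hx hy).
by case: (d && e); rewrite ?expr0 ?expr1 ?mul1r ?mulN1r.
Qed.
HB.instance Definition _ :=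
  Superalgebra_isCommutative.Build K (subsuper_sort S) subsuper_supermulrC.

Lemma subsuper_val_morph : superalg_morph (@subsuper_val K A S).
Proof. by split=> // x y. Qed.

End SubsuperCommutative.

Section NormalForm.
Variables (K : numFieldType) (A : comSuperalgType K).

Lemma mx11E (a b c d : A) : [/\ mxa (mx11 a b c d) = a,
  mxb (mx11 a b c d) = b, mxc (mx11 a b c d) = c & mxd (mx11 a b c d) = d].
Proof.
rewrite /mxa /mxb /mxc /mxd /mx11.
by rewrite block_mxEul block_mxEur block_mxEdl block_mxEdr !mxE.
Qed.

Lemma mulmx11 (a b c d a' b' c' d' : A) :
  mx11 a b c d *m mx11 a' b' c' d' =
  mx11 (a * a' + b * c') (a * b' + b * d') (c * a' + d * c') (c * b' + d * d').
Proof.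
rewrite /mx11 mulmx_block; congr block_mx;
  by apply/matrixP=> i j; rewrite !mxE !big_ord1 !mxE.
Qed.

Lemma mx11_1 : mx11 1 0 0 1 = 1%:M :> 'M[A]_(1 + 1).
Proof.
rewrite scalar_mx_block /mx11; congr block_mx;
  by apply/matrixP=> i j; rewrite !mxE ?ord1.
Qed.

Lemma mx11_inverse (b c d : A) : sunit d ->
  exists h, mx11 (d + b * sinv d * c) b c d *m h = 1%:M /\
            h *m mx11 (d + b * sinv d * c) b c d = 1%:M.
Proof.
move=> /sinvP[d1 d2].
exists (mx11 (sinv d) (- (sinv d * b * sinv d)) (- (sinv d * c * sinv d))
  (sinv d + sinv d * c * sinv d * b * sinv d)).
rewrite !mulmx11 -!mx11_1; split; congr mx11.
all: rewrite ?(mulrDl, mulrDr, mulrN, mulNr, mulrA) ?d1 ?d2 ?mul1r.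
all: rewrite -?(mulrA _ (sinv d) d) ?d2 ?mulr1.
all: try by rewrite ?addrK ?subrr.
all: try by rewrite -opprD addNr.
all: by rewrite addrC addrK.
Qed.

Lemma SL11_mx11 (b c d : A) : homog true b -> homog true c -> homog false d ->
  sunit d -> SL11 (mx11 (d + b * sinv d * c) b c d).
Proof.
move=> hb hc hd ud; have [d1 d2] := sinvP ud; have hd' := sinv_homog ud hd.
set a := d + _.
have ha : homog false a by apply: homogD; [|apply: (homogM (homogM hb hd') hc)].
have [Ea Eb Ec Ed] := mx11E a b c d.
split.
- move=> i j; case: (split_ordP i) => i' ->; case: (split_ordP j) => j' ->;
    rewrite !ord1; move: Ea Eb Ec Ed;
    rewrite /mxa /mxb /mxc /mxd => Ea Eb Ec Ed;
    by rewrite ?Ea ?Eb ?Ec ?Ed.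
- exact: mx11_inverse.
- by rewrite Ed.
- by rewrite /Ber /Ber_with Ea Eb Ec Ed /a addrK.
Qed.

Variables (p q : nat) (i0 : 'I_p) (m0 : 'I_q).
Variable M : 'M[A]_(1 + 1, p + q).
Hypothesis MP : Mtilde M.

Lemma Mtilde_even k : (homog false (M row0 (lshift q k)) *
  sunit (M row0 (lshift q k)) * homog true (M row1 (lshift q k)))%type.
Proof.
have [h u] := MP; have e : ipar (lshift q k) = false.
  by rewrite /ipar /= leqNgt ltn_ord.
split; first split.
- by have := h row0 (lshift q k); rewrite e.
- by apply: u; rewrite e.
- by have := h row1 (lshift q k); rewrite e.
Qed.

Lemma Mtilde_odd k : (homog false (M row1 (rshift p k)) *
  sunit (M row1 (rshift p k)) * homog true (M row0 (rshift p k)))%type.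
Proof.
have [h u] := MP; have e : ipar (rshift p k) = true.
  by rewrite /ipar /= leq_addr.
split; first split.
- by have := h row1 (rshift p k); rewrite e.
- by apply: u; rewrite e.
- by have := h row0 (rshift p k); rewrite e.
Qed.

Lemma SL11_Ber g k l : SL11 g ->
  Ber (row_mx (col k (g *m M)) (col (odc l) (g *m M))) =
  Ber (row_mx (col k M) (col (odc l) M)).
Proof.
move=> gP; have [[hd ud] hb] := Mtilde_odd l.
by rewrite !Ber_cols !mulmx_rows; apply: SL11_ber.
Qed.

Lemma SL11_Berstar g k l : SL11 g ->
  Berstar (row_mx (col (evc k) (g *m M)) (col l (g *m M))) =
  Berstar (row_mx (col (evc k) M) (col l M)).
Proof.
move=> gP; have [[ha ua] hc] := Mtilde_even k.
by rewrite !Berstar_cols !mulmx_rows; apply: SL11_ber_star.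
Qed.

Lemma SL11_normal_form : exists2 g, SL11 g & forall k,
  (g *m M) row0 k = Ber (row_mx (col k M) (col (odc m0) M)) /\
  (g *m M) row1 k = Ber (row_mx (col (evc i0) M) (col (odc m0) M)) *
                    Berstar (row_mx (col (evc i0) M) (col k M)).
Proof.
have [[ha ua] hc] := Mtilde_even i0; have [[hd ud] hb] := Mtilde_odd m0.
set a := M row0 (evc i0) in ha ua; set c := M row1 (evc i0) in hc.
set b := M row0 (odc m0) in hb; set d := M row1 (odc m0) in hd ud.
have [a1 a2] := sinvP ua; have ha' := sinv_homog ua ha.
have hca : homog true (c * sinv a) := homogM hc ha'.
pose e := d + (- (c * sinv a)) * b.
have he : homog false e.
  by apply: homogD => //; apply: (homogM (homogN hca) hb).
have ue : sunit e by apply: sunitD_odd => //; apply: homogN.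
have [e1 e2] := sinvP ue; have he' := sinv_homog ue he.
pose gd := sinv e; pose gc := sinv e * (- (c * sinv a)).
pose gb := - (sinv e * b * sinv e).
have hgc : homog true gc := homogM he' (homogN hca).
have hgb : homog true gb := homogN (homogM (homogM he' hb) he').
have ugd : sunit gd by exists e.
have gP := SL11_mx11 hgb hgc he' ugd.
set g := mx11 _ _ _ _ in gP; exists g => // k.
have [Ea Eb Ec Ed] := mx11E (gd + gb * sinv gd * gc) gb gc gd.
have bot l : (g *m M) row1 l = sinv e * (M row1 l - c * sinv a * M row0 l).
  rewrite mulmx_rows -/(mxc g) -/(mxd g) Ec Ed mulrBr /gc mulrN mulNr.
  by rewrite addrC !mulrA.
have top l : (g *m M) row0 l =
    gd * M row0 l + gb * e * ((g *m M) row1 l).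
  rewrite !mulmx_rows -/(mxa g) -/(mxb g) -/(mxc g) -/(mxd g) Ea Eb Ec Ed.
  rewrite (sinv_eq e2 e1) mulrDl (mulrDr (gb * e)) -addrA !mulrA.
  congr (_ + (_ + _)).
  by rewrite -(mulrA gb e) e1 mulr1.
have bot_i0 : (g *m M) row1 (evc i0) = 0.
  by rewrite bot -/a -/c -mulrA a2 mulr1 subrr mulr0.
have bot_m0 : (g *m M) row1 (odc m0) = 1.
  by rewrite bot -/b -/d -mulNr e2.
have top_m0 : (g *m M) row0 (odc m0) = 0.
  rewrite top bot_m0 mulr1 -/b /gb mulNr -(mulrA (sinv e * b)) e2 mulr1.
  by rewrite subrr.
have s1 : sinv (1 : A) = 1 by apply: sinv_eq; rewrite mulr1.
have H0 l : (g *m M) row0 l = Ber (row_mx (col l M) (col (odc m0) M)).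
  rewrite -(SL11_Ber _ _ gP) Ber_cols bot_m0 top_m0 /ber s1 mul1r.
  by rewrite mul0r mul0r subr0.
split=> //; rewrite -(SL11_Berstar _ _ gP) Berstar_cols bot_i0 -H0 /ber.
have [_ u] := SL11_act gP MP.
have /sinvP[u1 _] : sunit ((g *m M) row0 (evc i0)).
  by apply: u; rewrite /ipar /= leqNgt ltn_ord.
by rewrite mul0r mul0r subr0 mulrA u1 mul1r.
Qed.

End NormalForm.

Section SuperMinors.
Variables (K : numFieldType) (A : comSuperalgType K) (p q : nat).
Variable M : 'M[A]_(1 + 1, p + q).
Hypothesis MP : Mtilde M.
Variable f : freeY K p q -> A.
Hypotheses (fP : superalg_morph f)
  (fY : forall i mu,
     f (Y K i mu) = Ber (row_mx (col (evc i) M) (col (odc mu) M)))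
  (fYfake : forall mu nu,
     f (Yfake K p mu nu) = Ber (row_mx (col (odc mu) M) (col (odc nu) M)))
  (fYstar : forall i mu,
     f (Ystar K i mu) = Berstar (row_mx (col (evc i) M) (col (odc mu) M)))
  (fYstar_fake : forall i j,
     f (Ystar_fake K q i j) = Berstar (row_mx (col (evc i) M) (col (evc j) M))).

Lemma super_minors_plucker s : super_plucker s -> f s = 0.
Proof.
have Xe k := Mtilde_even MP k; have Xo k := Mtilde_odd MP k.
case=> [i mu|i j mu nu|i mu nu la|i j k mu].
- rewrite (morphS_B fP) (morphS_M fP) (morphS_1 fP) fY fYstar.
  rewrite Ber_cols Berstar_cols.
  have [[? ?] ?] := Xe i; have [[? ?] ?] := Xo mu.
  by rewrite ber_mul_star ?subrr.
- rewrite Ber_with_mx11 (morphS_Ber _ _ _ _ _ _ fP) !fY fYfake fYstar_fake.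
  rewrite !Ber_cols Berstar_cols; apply/eqP; rewrite subr_eq0; apply/eqP.
  have [[? ?] ?] := Xe i; have [[? ?] ?] := Xe j.
  have [[? ?] ?] := Xo mu; have [[? ?] ?] := Xo nu.
  exact: ber_plucker_even.
- rewrite Ber_with_mx11 (morphS_Ber _ _ _ _ _ _ fP) !fY !fYfake fYstar.
  rewrite !Ber_cols Berstar_cols; apply/eqP; rewrite subr_eq0; apply/eqP.
  have [[? ?] ?] := Xe i; have [[? ?] ?] := Xo mu.
  have [[? ?] ?] := Xo nu; have [[? ?] ?] := Xo la.
  exact: ber_plucker_fake.
- rewrite Berstar_with_mx11 (morphS_Ber _ _ _ _ _ _ fP) fY !fYstar !fYstar_fake.
  rewrite Ber_cols !Berstar_cols; apply/eqP; rewrite subr_eq0; apply/eqP.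
  have [[? ?] ?] := Xe i; have [[? ?] ?] := Xe j.
  have [[? ?] ?] := Xe k; have [[? ?] ?] := Xo mu.
  exact: ber_plucker_fake.
Qed.

End SuperMinors.

Section PluckerSolutions.
Variables (K : numFieldType) (B : comSuperalgType K) (p q : nat).
Variables (y : 'I_p -> 'I_q -> B) (yf : 'I_q -> 'I_q -> B).
Variables (ys : 'I_p -> 'I_q -> B) (ysf : 'I_p -> 'I_p -> B).
Hypotheses (hy : forall i mu, homog false (y i mu))
  (hyf : forall mu nu, homog true (yf mu nu))
  (hys : forall i mu, homog false (ys i mu))
  (hysf : forall i j, homog true (ysf i j)).
Hypotheses (y_ys : forall i mu, y i mu * ys i mu = 1)
  (y_even : forall i j mu nu, y i mu * y j nu =
     y i nu * (y j mu - yf nu mu * y i nu * ysf i j))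
  (y_fake : forall i mu nu la, y i mu * yf la nu =
     y i nu * (yf la mu - yf nu mu * y i nu * ys i la))
  (ys_fake : forall i j k mu, ys i mu * ysf j k =
     ys j mu * (ysf i k - ysf i j * ys j mu * y k mu)).
Variables (i0 : 'I_p) (m0 : 'I_q).

Definition normal_mx : 'M[B]_(1 + 1, p + q) :=
  block_mx (\row_k y k m0) (\row_k yf k m0)
    (\row_k (y i0 m0 * ysf i0 k)) (\row_k (y i0 m0 * ys i0 k)).
Local Notation N := normal_mx.

Lemma normal_mxE : ((forall k, N row0 (evc k) = y k m0) *
  (forall k, N row0 (odc k) = yf k m0) *
  (forall k, N row1 (evc k) = (y i0 m0 * ysf i0 k)%R) *
  (forall k, N row1 (odc k) = (y i0 m0 * ys i0 k)%R))%type.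
Proof.
split; first split; first split; move=> k; rewrite /N.
- by rewrite block_mxEul mxE.
- by rewrite block_mxEur mxE.
- by rewrite block_mxEdl mxE.
- by rewrite block_mxEdr mxE.
Qed.

Let ys_y i mu : ys i mu * y i mu = 1.
Proof. by rewrite -(even_comm _ (hy i mu)). Qed.

Let y_unit i mu : sunit (y i mu). Proof. by exists (ys i mu). Qed.
Let ys_unit i mu : sunit (ys i mu). Proof. by exists (y i mu). Qed.

Lemma normal_Mtilde : Mtilde N.
Proof.
split=> i j; case: (split_ordP i) => i' ->; rewrite ord1;
  case: (split_ordP j) => k ->; rewrite normal_mxE /ipar /= ?leq_addr
  ?[(_ <= k)%N]leqNgt ?ltn_ord //=.
- exact: (homogM (hy i0 m0) (hysf i0 k)).
- exact: (homogM (hy i0 m0) (hys i0 k)).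
- by move=> _; apply: sunitM.
Qed.

Let ber_normal a b c mu :
  ber a b (y i0 m0 * c) (y i0 m0 * ys i0 mu) =
  ys i0 m0 * (y i0 mu * (a - b * y i0 mu * c)).
Proof.
rewrite /ber sinvM // (sinv_eq (y_ys i0 m0) (ys_y i0 m0)).
rewrite (sinv_eq (ys_y i0 mu) (y_ys i0 mu)) -(mulrA b).
have -> : y i0 mu * ys i0 m0 * (y i0 m0 * c) = y i0 mu * c.
  by rewrite -mulrA (mulrA (ys i0 m0)) ys_y mul1r.
by rewrite (even_comm (ys i0 m0) (hy i0 mu)) !mulrA.
Qed.

Lemma normal_Ber_even i mu :
  Ber (row_mx (col (evc i) N) (col (odc mu) N)) = y i mu.
Proof.
by rewrite Ber_cols !normal_mxE ber_normal -y_even mulrA ys_y mul1r.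
Qed.

Lemma normal_Ber_fake mu nu :
  Ber (row_mx (col (odc mu) N) (col (odc nu) N)) = yf mu nu.
Proof.
by rewrite Ber_cols !normal_mxE ber_normal -y_fake mulrA ys_y mul1r.
Qed.

Lemma normal_Berstar_even i mu :
  Berstar (row_mx (col (evc i) N) (col (odc mu) N)) = ys i mu.
Proof.
have [[ha ua] hc] := Mtilde_even normal_Mtilde i.
have [[hd ud] hb] := Mtilde_odd normal_Mtilde mu.
have := ber_mul_star ha ua hb hc hd ud.
rewrite -Ber_cols -Berstar_cols normal_Ber_even.
by move/(congr1 (fun z => ys i mu * z)); rewrite mulrA ys_y mul1r mulr1.
Qed.

Lemma normal_Berstar_fake i j :
  Berstar (row_mx (col (evc i) N) (col (evc j) N)) = ysf i j.
Proof.
rewrite Berstar_cols !normal_mxE /ber (sinv_eq (y_ys i m0) (ys_y i m0)).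
rewrite -!(mulrA (y i0 m0)) -mulrBr mulrA -(even_comm _ (hy i0 m0)).
by rewrite -(mulrA (y i0 m0)) -ys_fake mulrA y_ys mul1r.
Qed.

End PluckerSolutions.

Section Substitution.
Variables (K : numFieldType) (p q : nat).
Local Notation X := (Xgeneric K p q).

Lemma Xgeneric_Mtilde : Mtilde X.
Proof.
split=> i j; rewrite mxE; first exact: (@loc_gen_homog K _ _ (i, j)).
by move=> e; apply: (@loc_gen_unit K _ _ (i, j)).
Qed.

Section Target.
Variables (A : comSuperalgType K) (M : 'M[A]_(1 + 1, p + q)).
Hypothesis MP : Mtilde M.

Lemma substE i j : subst M (X i j) = M i j.
Proof.
have [h u] := MP.
rewrite mxE /subst (@loc_evalE K _ (@entry_par p q)) // => -[k l].
  exact: h.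
exact: u.
Qed.

Lemma subst_uniq (f : Otilde K p q -> A) : superalg_morph f ->
  (forall i j, f (X i j) = M i j) -> f =1 subst M.
Proof.
have [h u] := MP; move=> fP fX; apply: loc_eval_uniq => // -[i j].
- exact: h.
- exact: u.
- by rewrite -fX mxE.
Qed.

Lemma subst_Ber k l : subst M (Ber (row_mx (col k X) (col (rshift p l) X))) =
  Ber (row_mx (col k M) (col (rshift p l) M)).
Proof.
have [[_ u] _] := Mtilde_odd Xgeneric_Mtilde l.
by rewrite !Ber_cols (morphS_ber _ _ _ (subst_morph MP) u) !substE.
Qed.

Lemma subst_Berstar k l :
  subst M (Berstar (row_mx (col (lshift q k) X) (col l X))) =
  Berstar (row_mx (col (lshift q k) M) (col l M)).
Proof.
have [[_ u] _] := Mtilde_even Xgeneric_Mtilde k.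
by rewrite !Berstar_cols (morphS_ber _ _ _ (subst_morph MP) u) !substE.
Qed.

End Target.

Lemma subst_Xgeneric f : subst X f = f.
Proof. by rewrite -(subst_uniq Xgeneric_Mtilde (f := id)). Qed.

Lemma Ber_invariant k l :
  SL_invariant (Ber (row_mx (col k X) (col (rshift p l) X))).
Proof.
move=> A g M gP MP; rewrite !subst_Ber ?SL11_Ber //; exact: SL11_act.
Qed.

Lemma Berstar_invariant k l :
  SL_invariant (Berstar (row_mx (col (lshift q k) X) (col l X))).
Proof.
move=> A g M gP MP; rewrite !subst_Berstar ?SL11_Berstar //; exact: SL11_act.
Qed.

Lemma homog_Ber_X k l :
  homog (ipar k) (Ber (row_mx (col k X) (col (rshift p l) X))).
Proof.
have [[hd ud] hb] := Mtilde_odd Xgeneric_Mtilde l.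
rewrite Ber_cols; apply: (homog_Ber (sinv_homog ud hd) _ hb).
- by case: Xgeneric_Mtilde => /(_ row0 k).
- by case: Xgeneric_Mtilde => /(_ row1 k); rewrite addbC.
Qed.

Lemma homog_Berstar_X k l :
  homog (~~ ipar l) (Berstar (row_mx (col (lshift q k) X) (col l X))).
Proof.
have [[hd ud] hb] := Mtilde_even Xgeneric_Mtilde k.
rewrite Berstar_cols; apply: (homog_Ber (sinv_homog ud hd) _ hb).
- by case: Xgeneric_Mtilde => /(_ row1 l).
- by case: Xgeneric_Mtilde => /(_ row0 l); rewrite addbT negbK.
Qed.

End Substitution.

Section Isomorphism.
Variables (K : numFieldType) (p q : nat).

Local Notation X := (Xgeneric K p q).
Local Notation P := (presented K p q).
Local Notation S := (super_pluckers K p q).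
Local Notation Inv := (subsuper_sort (SL_invariants K p q)).

Definition inv_of (f : Otilde K p q) (h : SL_invariant f) : Inv :=
  Subsuper (asboolT (h : SL_invariants K p q f)).

Definition Yimage (y : Yvar p q) : Inv :=
  match y with
  | Yev i mu => inv_of (Ber_invariant (lshift q i) mu)
  | Yod mu nu => inv_of (Ber_invariant (rshift p mu) nu)
  | Ysev i mu => inv_of (Berstar_invariant i (rshift p mu))
  | Ysod i j => inv_of (Berstar_invariant i (lshift q j))
  end.

Lemma Yimage_homog y : homog (Yvar_par y) (Yimage y).
Proof.
case: y => i j /=.
- have := @homog_Ber_X K p q (lshift q i) j.
  by rewrite {1}/ipar /= leqNgt ltn_ord.
- have := @homog_Ber_X K p q (rshift p i) j.
  by rewrite {1}/ipar /= leq_addr.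
- have := @homog_Berstar_X K p q i (rshift p j).
  by rewrite {1}/ipar /= leq_addr.
- have := @homog_Berstar_X K p q i (lshift q j).
  by rewrite {1}/ipar /= leqNgt ltn_ord.
Qed.

Definition Yeval : freeY K p q -> Inv := free_eval Yimage.

Lemma Yeval_morph : superalg_morph Yeval.
Proof. exact: free_eval_morph Yimage_homog. Qed.

Lemma Yeval_plucker s : super_plucker s -> Yeval s = 0.
Proof.
move=> hs; apply: val_inj.
have Vm := subsuper_val_morph (SL_invariants K p q).
have E y : subsuper_val (Yeval (free_gen K _ y)) = subsuper_val (Yimage y).
  by rewrite /Yeval (free_evalE Yimage_homog).
apply: (super_minors_plucker (Xgeneric_Mtilde K p q)
  (superalg_morph_comp Vm Yeval_morph) _ _ _ _ hs) => i j; exact: E.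
Qed.

Lemma Yeval_gen y : Yeval (free_gen K _ y) = Yimage y.
Proof. exact: free_evalE Yimage_homog y. Qed.

Local Notation proj := (superproj (S)).

Definition inv_of_presented : P -> Inv := quot_lift Yeval.

Lemma inv_of_presented_morph : superalg_morph inv_of_presented.
Proof. exact: (quot_lift_morph (S := S) Yeval_morph Yeval_plucker). Qed.

Lemma inv_of_presentedE x : inv_of_presented (proj x) = Yeval x.
Proof. exact: (quot_liftE (S := S) Yeval_morph Yeval_plucker). Qed.

Lemma presented_inv i mu : proj (Y K i mu) * proj (Ystar K i mu) = 1.
Proof.
have pP := superproj_morph (S).
have /(superproj_rel (S := S)) := Plucker_inv K i mu.
rewrite (morphS_B pP) (morphS_M pP) (morphS_1 pP) => /eqP.
by rewrite subr_eq0 => /eqP.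
Qed.

Lemma presented_even i j mu nu : proj (Y K i mu) * proj (Y K j nu) =
  proj (Y K i nu) * (proj (Y K j mu) -
    proj (Yfake K p nu mu) * proj (Y K i nu) * proj (Ystar_fake K q i j)).
Proof.
have pP := superproj_morph (S).
have /(superproj_rel (S := S)) := Plucker_even K i j mu nu.
rewrite Ber_with_mx11 (morphS_Ber _ _ _ _ _ _ pP) => /eqP.
by rewrite subr_eq0 => /eqP.
Qed.

Lemma presented_fake i mu nu la : proj (Y K i mu) * proj (Yfake K p la nu) =
  proj (Y K i nu) * (proj (Yfake K p la mu) -
    proj (Yfake K p nu mu) * proj (Y K i nu) * proj (Ystar K i la)).
Proof.
have pP := superproj_morph (S).
have /(superproj_rel (S := S)) := Plucker_fake K i mu nu la.
rewrite Ber_with_mx11 (morphS_Ber _ _ _ _ _ _ pP) => /eqP.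
by rewrite subr_eq0 => /eqP.
Qed.

Lemma presented_star_fake i j k mu :
  proj (Ystar K i mu) * proj (Ystar_fake K q j k) =
  proj (Ystar K j mu) * (proj (Ystar_fake K q i k) -
    proj (Ystar_fake K q i j) * proj (Ystar K j mu) * proj (Y K k mu)).
Proof.
have pP := superproj_morph (S).
have /(superproj_rel (S := S)) := Plucker_star_fake K i j k mu.
rewrite Berstar_with_mx11 (morphS_Ber _ _ _ _ _ _ pP) => /eqP.
by rewrite subr_eq0 => /eqP.
Qed.

Lemma proj_gen_homog y : homog (Yvar_par y) (proj (free_gen K _ y)).
Proof. by apply: (morphS_homog (superproj_morph _)); apply: free_gen_homog. Qed.

Definition presented_mx (i0 : 'I_p) (m0 : 'I_q) : 'M[P]_(1 + 1, p + q) :=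
  normal_mx (fun i mu => proj (Y K i mu)) (fun mu nu => proj (Yfake K p mu nu))
    (fun i mu => proj (Ystar K i mu)) (fun i j => proj (Ystar_fake K q i j))
    i0 m0.

Section Basepoint.
Variables (i0 : 'I_p) (m0 : 'I_q).
Local Notation N := (presented_mx i0 m0).

Let hY i mu : homog false (proj (Y K i mu)) := proj_gen_homog (Yev i mu).
Let hYf mu nu : homog true (proj (Yfake K p mu nu)) :=
  proj_gen_homog (Yod p mu nu).
Let hYs i mu : homog false (proj (Ystar K i mu)) := proj_gen_homog (Ysev i mu).
Let hYsf i j : homog true (proj (Ystar_fake K q i j)) :=
  proj_gen_homog (Ysod q i j).

Lemma presented_mx_Mtilde : Mtilde N.
Proof. exact: (normal_Mtilde hY hYf hYs hYsf presented_inv). Qed.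

Definition presented_of_inv (f : Inv) : P := subst N (subsuper_val f).

Lemma inv_of_presentedK : cancel inv_of_presented presented_of_inv.
Proof.
have NP := presented_mx_Mtilde.
elim/quot_ind=> x; rewrite /presented_of_inv inv_of_presentedE.
have Vm := superalg_morph_comp (subsuper_val_morph (SL_invariants K p q))
  Yeval_morph.
have Fm := superalg_morph_comp (subst_morph NP) Vm.
have pP := superproj_morph (S).
rewrite [RHS](free_eval_uniq proj_gen_homog pP (fun y => erefl)).
apply: (free_eval_uniq proj_gen_homog Fm) => y.
rewrite /= Yeval_gen; case: y => i j /=.
- rewrite (subst_Ber NP).
  exact: (normal_Ber_even hY presented_inv presented_even).
- rewrite (subst_Ber NP).
  exact: (normal_Ber_fake _ hY presented_inv presented_fake).
- rewrite (subst_Berstar NP).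
  exact: (normal_Berstar_even hY hYf hYs hYsf presented_inv presented_even).
- rewrite (subst_Berstar NP).
  exact: (normal_Berstar_fake _ hY presented_inv presented_star_fake).
Qed.

Lemma presented_of_invK : cancel presented_of_inv inv_of_presented.
Proof.
have NP := presented_mx_Mtilde; have XP := Xgeneric_Mtilde K p q.
move=> f; apply: val_inj; rewrite /= /presented_of_inv.
have [g gP gX] := SL11_normal_form i0 m0 XP.
have Vm := subsuper_val_morph (SL_invariants K p q).
have Fm := superalg_morph_comp Vm
  (superalg_morph_comp inv_of_presented_morph (subst_morph NP)).
have gf : subst (g *m X) (subsuper_val f) = subsuper_val f.
  rewrite -[RHS]subst_Xgeneric.
  exact: (asboolW (subsuper_valP f) _ _ _ gP XP).
rewrite -[RHS]gf; apply: (subst_uniq (SL11_act gP XP) Fm) => i j /=.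
rewrite substE //.
have IM := inv_of_presented_morph.
have gX0 k := proj1 (gX k); have gX1 k := proj2 (gX k).
case: (split_ordP i) => i' ->; rewrite ord1;
  case: (split_ordP j) => k ->; rewrite normal_mxE ?gX0 ?gX1.
- by rewrite inv_of_presentedE Yeval_gen.
- by rewrite inv_of_presentedE Yeval_gen.
- by rewrite (morphS_M IM) !inv_of_presentedE (morphS_M Vm) !Yeval_gen.
- by rewrite (morphS_M IM) !inv_of_presentedE (morphS_M Vm) !Yeval_gen.
Qed.

End Basepoint.

End Isomorphism.

Theorem theorem6p4 (R : realType) (p q : nat) (hp : (0 < p)%N) (hq : (0 < q)%N) :
  exists phi : presented R[i] p q -> subsuper_sort (SL_invariants R[i] p q),
    superalg_iso phi /\
    [/\ forall (i : 'I_p) (mu : 'I_q),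
          subsuper_val (phi (superproj _ (Y R[i] i mu))) = superminor R[i] i mu,
        forall mu nu : 'I_q,
          subsuper_val (phi (superproj _ (Yfake R[i] p mu nu))) =
          fake_superminor R[i] p mu nu,
        forall (j : 'I_p) (nu : 'I_q),
          subsuper_val (phi (superproj _ (Ystar R[i] j nu))) =
          superminor_star R[i] j nu
      & forall i j : 'I_p,
          subsuper_val (phi (superproj _ (Ystar_fake R[i] q i j))) =
          fake_superminor_star R[i] q i j].
Proof.
exists (@inv_of_presented R[i] p q); split.
  split; first exact: inv_of_presented_morph.
  exists (@presented_of_inv R[i] p q (Ordinal hp) (Ordinal hq)).
  - exact: inv_of_presentedK.
  - exact: presented_of_invK.
by split=> i j; rewrite inv_of_presentedE Yeval_gen.
Qed.
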